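(* Let $u\in X_p$ be the solution of the primal weak problem and $\sigma=-A\nabla u-f_2$. There exist constants $c_1,C_1>0$ such that for every $(\tau,w)\in\Sigma_p\times X_p$, $$c_1\,|||(\sigma-\tau,u-w)|||\le\eta_p^{\mathrm{LS}}(\tau,w)\le C_1\,|||(\sigma-\tau,u-w)|||.$$
   Context: Domain and coefficients: $\Omega\subset\mathbb R^d$, $d\ge2$, is a bounded Lipschitz domain with outward unit normal $n$ and $\partial\Omega=\overline{\Gamma_D}\cup\overline{\Gamma_N}$, where $\Gamma_D,\Gamma_N$ are disjoint relatively open subsets of $\partial\Omega$ and $|\Gamma_D|>0$. $A\in L^\infty(\Omega;\mathbb R^{d\times d})$ is symmetric with $a_0|\xi|^2\le\xi^TA(x)\xi\le a_1|\xi|^2$ for all $\xi\in\mathbb R^d$ and a.e. $x$, where $0<a_0\le a_1<\infty$; $b\in L^\infty(\Omega)^d$, $c\in L^\infty(\Omega)$. Data: $f_1\in L^2(\Omega)$, $f_2\in L^2(\Omega)^d$, $\psi_p\in L^2(\Gamma_N)$, $\phi_p\in H^{1/2}(\Gamma_D)$ (restrictions to $\Gamma_D$ of $H^{1/2}(\partial\Omega)$ functions). Notation: $(\cdot,\cdot)$ and $\|\cdot\|_0$ are the $L^2(\Omega)$ inner product and norm, $\|\cdot\|_1$ the $H^1(\Omega)$ norm, $\langle\cdot,\cdot\rangle_{\Gamma_N}$ the $L^2(\Gamma_N)$ pairing of traces. $H_D^1(\Omega)=\{v\in H^1(\Omega):v=0\text{ on }\Gamma_D\}$, $X_p=\{w\in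 H^1(\Omega):w=\phi_p\text{ on }\Gamma_D\}$. For $\tau\in H(\mathrm{div};\Omega)$ and $\psi\in L^2(\Gamma_N)$, ''$\tau\cdot n=\psi$ on $\Gamma_N$'' means $(\tau,\nabla s_0)+(\nabla\cdot\tau,s_0)=\langle\psi,s_0\rangle_{\Gamma_N}$ for all $s_0\in H_D^1(\Omega)$. $\Sigma_p=\{\tau\in H(\mathrm{div};\Omega):\tau\cdot n=\psi_p\text{ on }\Gamma_N\}$, assumed nonempty. $|||(\tau,w)|||^2=\|\tau\|_{H(\mathrm{div};\Omega)}^2+\|w\|_1^2$ with $\|\tau\|_{H(\mathrm{div};\Omega)}^2=\|\tau\|_0^2+\|\nabla\cdot\tau\|_0^2$. $a(t,s)=(A\nabla t,\nabla s)+(b\cdot\nabla t+ct,s)$, $\ell(s)=(f_1,s)-(f_2,\nabla s)-\langle\psi_p,s\rangle_{\Gamma_N}$ for $t,s\in H^1(\Omega)$. Standing assumption (inf-sup): there is $\beta>0$ with $\beta=\inf_{0\ne w_0\in H_D^1(\Omega)}\sup_{0\ne v_0\in H_D^1(\Omega)}\frac{a(w_0,v_0)}{\|w_0\|_1\|v_0\|_1}=\inf_{0\ne v_0\in H_D^1(\Omega)}\sup_{0\ne w_0\in H_D^1(\Omega)}\frac{a(w_0,v_0)}{\|w_0\|_1\|v_0\|_1}$. Primal weak problem: $u\in X_p$, $a(u,s_0)=\ell(s_0)$ for all $s_0\in H_D^1(\Omega)$. Estimator: $\eta_p^{\mathrm{LS}}(\tau,w)=\bigl(\|A^{-1/2}\tau+A^{1/2}\nabla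 w+A^{-1/2}f_2\|_0^2+\|\nabla\cdot\tau+b\cdot\nabla w+cw-f_1\|_0^2\bigr)^{1/2}$. *)

(* Defs.v *)
From HB Require Import structures.
From mathcomp Require Import all_boot all_order all_algebra.
From mathcomp Require Import all_classical all_reals all_analysis.

Set Implicit Arguments.
Unset Strict Implicit.
Unset Printing Implicit Defensive.

Import Order.TTheory GRing.Theory Num.Theory.
Import numFieldNormedType.Exports.
Local Open Scope classical_set_scope.
Local Open Scope ring_scope.

(* Vectors of R^d are columns.  The norm that the library puts on matrices is
   the sup norm: it is used for the topology only, and enorm is the Euclidean
   norm. *)
Definition dotv (R : realType) (d : nat) (x y : 'cV[R]_d) : R :=
  \sum_(i < d) x i 0 * y i 0.

Definition enorm (R : realType) (d : nat) (x : 'cV[R]_d) : R :=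
  Num.sqrt (dotv x x).

Definition basisv (R : realType) (d : nat) (i : 'I_d) : 'cV[R]_d :=
  delta_mx i 0.

(* Outer measures obtained from a gauge zeta by countable covers.  The alias
   discr, in which every set is measurable, only serves to reuse the library's
   proof of sigma-subadditivity. *)
Section cover_outer.
Context (R : realType) (T : pointedType).
Local Open Scope ereal_scope.

Definition cover_outer (zeta : set T -> \bar R) (A : set T) : \bar R :=
  ereal_inf [set \sum_(k <oo) zeta (U k) |
             U in [set U : (set T)^nat | A `<=` \bigcup_k U k]].

Definition discr : Type := T.
HB.instance Definition _ := Pointed.on discr.
HB.instance Definition _ := @isMeasurable.Build default_measure_display
  discr discrete_measurable discrete_measurable0
  (@discrete_measurableC T) (@discrete_measurableU T).

Lemma cover_outerE (zeta : set T -> \bar R) :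
  cover_outer zeta = mu_ext (zeta : set discr -> \bar R).
Proof.
apply/funext => A; congr ereal_inf; apply/seteqP; split => x /= [U UA <-].
  by exists U.
by exists U => //; case: UA.
Qed.

Variable zeta : set T -> \bar R.
Hypotheses (zeta0 : zeta set0 = 0) (zeta_ge0 : forall A, 0 <= zeta A).

Lemma cover_outer0 : cover_outer zeta set0 = 0.
Proof. by rewrite cover_outerE; exact: mu_ext0. Qed.

Lemma cover_outer_ge0 A : 0 <= cover_outer zeta A.
Proof. by rewrite cover_outerE; exact: mu_ext_ge0. Qed.

Lemma le_cover_outer :
  {homo cover_outer zeta : A B / A `<=` B >-> A <= B}.
Proof.
move=> A B AB; rewrite cover_outerE.
exact: (@le_mu_ext _ discr).
Qed.

Lemma cover_outer_sigma_subadditive : sigma_subadditive (cover_outer zeta).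
Proof. by rewrite cover_outerE; exact: (@mu_ext_sigma_subadditive _ discr). Qed.

End cover_outer.

(* Lebesgue measure on R^d, on the sigma-algebra of Lebesgue (that is,
   Caratheodory) measurable sets.  The gauge is the volume on closed boxes and
   +oo (the infimum of the empty set) on nonempty sets that are not boxes. *)
Section lebesgue.
Context (R : realType) (d : nat).
Local Open Scope ereal_scope.

Definition box (a b : 'cV[R]_d) : set 'cV[R]_d :=
  [set x | forall i, (a i 0 <= x i 0 <= b i 0)%R].

Definition box_volume (U : set 'cV[R]_d) : \bar R :=
  if U == set0 then 0 else
  ereal_inf [set (\prod_(i < d) (p.2 i 0 - p.1 i 0))%:E |
             p in [set p : 'cV[R]_d * 'cV[R]_d | U = box p.1 p.2]].

Lemma box_volume0 : box_volume set0 = 0.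
Proof. by rewrite /box_volume eqxx. Qed.

Lemma box_volume_ge0 U : 0 <= box_volume U.
Proof.
rewrite /box_volume; case: eqP => // /eqP/set0P [x Ux].
apply: le_ereal_inf_tmp => _ [p /= Up <-]; rewrite lee_fin prodr_ge0// => i _.
by move: Ux; rewrite Up subr_ge0 => /(_ i)/andP[]; exact: le_trans.
Qed.

Definition lebesgue_outer : set 'cV[R]_d -> \bar R := cover_outer box_volume.

HB.instance Definition _ := isOuterMeasure.Build R _ lebesgue_outer
  (cover_outer0 box_volume0 box_volume_ge0) (cover_outer_ge0 box_volume_ge0)
  (@le_cover_outer _ _ box_volume)
  (cover_outer_sigma_subadditive box_volume_ge0).

Definition lebesgue_outer_measure : {outer_measure set 'cV[R]_d -> \bar R} :=
  lebesgue_outer.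

Definition Leb :
    {measure set (caratheodory_type lebesgue_outer_measure) -> \bar R} :=
  lebesgue_outer_measure : set (caratheodory_type lebesgue_outer_measure) -> _.

End lebesgue.

Arguments Leb : clear implicits.

(* m-dimensional Hausdorff measure on R^d, on its Caratheodory measurable sets,
   with the usual normalization by the volume omega_m of the unit ball of R^m:
   the gauge of U is omega_m (diam U / 2)^m. *)
Section hausdorff.
Context (R : realType) (m d : nat).
Local Open Scope ereal_scope.

Definition ediam (U : set 'cV[R]_d) : \bar R :=
  ereal_sup [set (enorm (p.1 - p.2))%:E |
             p in [set p : 'cV[R]_d * 'cV[R]_d | U p.1 /\ U p.2]].

Definition unit_ball_volume : R :=
  fine (lebesgue_outer [set x : 'cV[R]_m | (enorm x <= 1)%R]).

Definition hausdorff_gauge (delta : R) (U : set 'cV[R]_d) : \bar R :=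
  if U == set0 then 0 else
  if ediam U <= delta%:E then
    (unit_ball_volume * (fine (ediam U) / 2) ^+ m)%:E
  else +oo.

Definition hausdorff_outer (A : set 'cV[R]_d) : \bar R :=
  ereal_sup [set cover_outer (hausdorff_gauge delta) A |
             delta in [set delta : R | (0 < delta)%R]].

Lemma hausdorff_gauge0 delta : hausdorff_gauge delta set0 = 0.
Proof. by rewrite /hausdorff_gauge eqxx. Qed.

Lemma hausdorff_gauge_ge0 delta U : 0 <= hausdorff_gauge delta U.
Proof.
rewrite /hausdorff_gauge; case: eqP => // /eqP/set0P[x Ux].
case: ifP => // _; rewrite lee_fin mulr_ge0//.
  by rewrite fine_ge0// cover_outer_ge0//; exact: box_volume_ge0.
rewrite exprn_ge0// divr_ge0// fine_ge0//.
apply: (@le_trans _ _ (enorm (x - x))%:E); first by rewrite lee_fin sqrtr_ge0.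
by apply: ereal_sup_ubound; exists (x, x).
Qed.

Lemma hausdorff_outer0 : hausdorff_outer set0 = 0.
Proof.
apply/eqP; rewrite eq_le; apply/andP; split.
  apply: ge_ereal_sup => _ [e _ <-].
  by rewrite cover_outer0//; [exact: hausdorff_gauge0|exact: hausdorff_gauge_ge0].
apply: ereal_sup_ubound; exists 1%R; first exact: ltr01.
by rewrite cover_outer0//; [exact: hausdorff_gauge0|exact: hausdorff_gauge_ge0].
Qed.

Lemma hausdorff_outer_ge0 A : 0 <= hausdorff_outer A.
Proof.
apply: (@le_trans _ _ (cover_outer (hausdorff_gauge 1) A)).
  by apply: cover_outer_ge0; exact: hausdorff_gauge_ge0.
by apply: ereal_sup_ubound; exists 1%R => //; exact: ltr01.
Qed.

Lemma le_hausdorff_outer :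
  {homo hausdorff_outer : A B / A `<=` B >-> A <= B}.
Proof.
move=> A B AB; apply: ge_ereal_sup => _ [e e0 <-].
apply: (@le_trans _ _ (cover_outer (hausdorff_gauge e) B)).
  exact: le_cover_outer.
by apply: ereal_sup_ubound; exists e.
Qed.

Lemma hausdorff_outer_sigma_subadditive : sigma_subadditive hausdorff_outer.
Proof.
move=> F; apply: ge_ereal_sup => _ [e e0 <-].
apply: (@le_trans _ _ (\sum_(i <oo) cover_outer (hausdorff_gauge e) (F i))).
  by apply: cover_outer_sigma_subadditive; exact: hausdorff_gauge_ge0.
apply: lee_nneseries => i _.
  by move=> _; apply: cover_outer_ge0; exact: hausdorff_gauge_ge0.
by apply: ereal_sup_ubound; exists e.
Qed.

HB.instance Definition _ := isOuterMeasure.Build R _ hausdorff_outer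
  hausdorff_outer0 hausdorff_outer_ge0 le_hausdorff_outer
  hausdorff_outer_sigma_subadditive.

Definition hausdorff_outer_measure : {outer_measure set 'cV[R]_d -> \bar R} :=
  hausdorff_outer.

Definition Hausdorff :
    {measure set (caratheodory_type hausdorff_outer_measure) -> \bar R} :=
  hausdorff_outer_measure :
    set (caratheodory_type hausdorff_outer_measure) -> _.

End hausdorff.

Arguments Hausdorff : clear implicits.

(* Surface measure: (d-1)-dimensional Hausdorff measure. *)
Notation Surf R d := (Hausdorff R d.-1 d).

Section lebesgue_spaces.
Context (disp : measure_display) (T : measurableType disp) (R : realType).

Definition L2 (mu : {measure set T -> \bar R}) (D : set T) (f : T -> R) : Prop :=
  measurable_fun D f /\ mu.-integrable D (fun x => (f x ^+ 2)%:E).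

Definition Linfty (mu : {measure set T -> \bar R}) (D : set T) (f : T -> R) :
    Prop :=
  measurable_fun D f /\
  exists M : R, {ae mu, forall x, D x -> `|f x| <= M}.

End lebesgue_spaces.

Section domain.
Context (R : realType) (d : nat).
Implicit Types Omega Gamma : set 'cV[R]_d.

Definition bdry Omega : set 'cV[R]_d := closure Omega `\` interior Omega.

(* Near each boundary point, and in suitable orthonormal coordinates, Omega is
   the part of space above the graph of a Lipschitz function of the first d-1
   coordinates.  Here e is the last coordinate direction, and a function of the
   other coordinates is a function gamma on R^d that is invariant along e. *)
Definition locally_lipschitz_graph Omega : Prop :=
  forall x0, bdry Omega x0 ->
  exists (r L : R) (e : 'cV[R]_d) (gamma : 'cV[R]_d -> R),
    [/\ 0 < r /\ enorm e = 1,
        forall x y, `|gamma x - gamma y| <= L * enorm (x - y),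
        forall x (t : R), gamma (x + t *: e) = gamma x
      & forall x, enorm (x - x0) < r -> (Omega x <-> gamma x < dotv x e)].

Definition lipschitz_domain Omega : Prop :=
  [/\ open Omega, connected Omega, Omega !=set0
    & locally_lipschitz_graph Omega].

Definition relatively_open_in_bdry Omega Gamma : Prop :=
  exists2 U : set 'cV[R]_d, open U & Gamma = bdry Omega `&` U.

(* Smooth functions on R^d: partial derivatives of every order exist and are
   continuous. *)
Definition partials (s : seq 'I_d) (f : 'cV[R]_d -> R) : 'cV[R]_d -> R :=
  foldr (fun i g => fun x => 'D_(basisv R i) g x) f s.

Definition smooth (f : 'cV[R]_d -> R) : Prop :=
  forall s : seq 'I_d, continuous (partials s f) /\
    forall x i, derivable (partials s f) x (basisv R i).

Definition gradient (f : 'cV[R]_d -> R) (x : 'cV[R]_d) : 'cV[R]_d :=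
  \col_i 'D_(basisv R i) f x.

Definition test_function Omega (phi : 'cV[R]_d -> R) : Prop :=
  smooth phi /\
  exists K : set 'cV[R]_d,
    [/\ compact K, K `<=` Omega & forall x, ~ K x -> phi x = 0].

End domain.

Section function_spaces.
Context (R : realType) (d : nat).
Implicit Types (Omega Gamma : set 'cV[R]_d) (f g : 'cV[R]_d -> R).
Implicit Types (F G : 'cV[R]_d -> 'cV[R]_d).

(* L^oo(Omega), L^2(Omega) and L^2(Omega)^d: functions are defined on all of R^d, and only
   their restriction to Omega matters. *)
Definition Linftys Omega f : Prop := Linfty (Leb R d) Omega f.
Definition L2s Omega f : Prop := L2 (Leb R d) Omega f.
Definition L2v Omega F : Prop := forall i : 'I_d, L2s Omega (fun x => F x i 0).

Definition ips Omega f g : R := \int[Leb R d]_(x in Omega) (f x * g x).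
Definition ipv Omega F G : R := \int[Leb R d]_(x in Omega) dotv (F x) (G x).

Definition weak_gradient Omega f G : Prop :=
  forall phi, test_function Omega phi -> forall i : 'I_d,
    ips Omega f (fun x => gradient phi x i 0) =
    - ips Omega (fun x => G x i 0) phi.

Definition weak_divergence Omega F g : Prop :=
  forall phi, test_function Omega phi ->
    ipv Omega F (gradient phi) = - ips Omega g phi.

(* A weak gradient or divergence is determined up to a null set; elements of
   H^1(Omega) and H(div; Omega) carry a representative of theirs. *)
Record H1 Omega := MkH1 {
  h1val :> 'cV[R]_d -> R ;
  h1grad : 'cV[R]_d -> 'cV[R]_d ;
  h1val_L2 : L2s Omega h1val ;
  h1grad_L2 : L2v Omega h1grad ;
  h1_weak_gradient : weak_gradient Omega h1val h1grad }.

Record Hdiv Omega := MkHdiv {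
  hdivval :> 'cV[R]_d -> 'cV[R]_d ;
  hdivdiv : 'cV[R]_d -> R ;
  hdivval_L2 : L2v Omega hdivval ;
  hdivdiv_L2 : L2s Omega hdivdiv ;
  hdiv_weak_divergence : weak_divergence Omega hdivval hdivdiv }.

(* Squares of the norms of (f, grad f = G) in H^1 and of (F, div F = g) in
   H(div). *)
Definition sqnorm1 Omega f G : R := ips Omega f f + ipv Omega G G.
Definition sqnormdiv Omega F g : R := ipv Omega F F + ips Omega g g.

Definition norm1 Omega (v : H1 Omega) : R := Num.sqrt (sqnorm1 Omega v (h1grad v)).

(* |||(sigma - tau, u - w)||| *)
Definition triple_norm_diff Omega (sigma tau : Hdiv Omega) (u w : H1 Omega) : R :=
  Num.sqrt (sqnormdiv Omega (sigma \- tau) (hdivdiv sigma \- hdivdiv tau) +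
            sqnorm1 Omega (u \- w) (h1grad u \- h1grad w)).

(* g in L^2(bdry Omega) is the trace of v when (v, g) is a limit in
   H^1(Omega) x L^2(bdry Omega) of (phi_n, phi_n|bdry Omega) with phi_n smooth
   up to the boundary: this is the graph of the trace operator, the continuous
   extension of restriction to the boundary.  On a bounded Lipschitz domain
   every v in H^1(Omega) has exactly one trace, up to surface null sets. *)
Definition is_trace Omega (v : H1 Omega) g : Prop :=
  L2 (Surf R d) (bdry Omega) g /\
  exists phi : nat -> 'cV[R]_d -> R,
    [/\ forall n, smooth (phi n),
        (\int[Leb R d]_(x in Omega)
           ((phi n x - v x) ^+ 2
            + enorm (gradient (phi n) x - h1grad v x) ^+ 2)%:E)%E
          @[n --> \oo] --> 0%:E
      & (\int[Surf R d]_(x in bdry Omega) ((phi n x - g x) ^+ 2)%:E)%E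
          @[n --> \oo] --> 0%:E].

Definition trace_eq_on Omega Gamma (v : H1 Omega) (psi : 'cV[R]_d -> R) : Prop :=
  exists2 g, is_trace v g
           & {ae Surf R d, forall x, Gamma x -> g x = psi x}.

Definition H1D Omega GammaD (v : H1 Omega) : Prop :=
  trace_eq_on GammaD v (fun=> 0).

(* <psi, s>_Gamma, where g is the trace of s *)
Definition ipb Gamma (psi g : 'cV[R]_d -> R) : R :=
  \int[Surf R d]_(x in Gamma) (psi x * g x).

Definition normal_trace_eq Omega GammaD GammaN (tau : Hdiv Omega)
    (psi : 'cV[R]_d -> R) : Prop :=
  forall s0 : H1 Omega, H1D GammaD s0 -> forall g, is_trace s0 g ->
    ipv Omega tau (h1grad s0) + ips Omega (hdivdiv tau) s0 = ipb GammaN psi g.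

(* H^{1/2}(bdry Omega), by the Sobolev-Slobodeckij seminorm on a
   (d-1)-dimensional surface. *)
Definition Hhalf_bdry Omega f : Prop :=
  L2 (Surf R d) (bdry Omega) f /\
  (\int[Surf R d]_(x in bdry Omega) \int[Surf R d]_(y in bdry Omega)
     ((f x - f y) ^+ 2 / enorm ((x : 'cV[R]_d) - (y : 'cV[R]_d)) ^+ d)%:E < +oo)%E.

Definition Hhalf_on Omega Gamma f : Prop :=
  exists2 h, Hhalf_bdry Omega h
           & {ae Surf R d, forall x, Gamma x -> f x = h x}.

End function_spaces.

Section problem.
Context (R : realType) (d : nat) (Omega GammaD GammaN : set 'cV[R]_d).

Definition elliptic (A : 'cV[R]_d -> 'M[R]_d) (a0 a1 : R) : Prop :=
  {ae Leb R d, forall x, Omega x -> (A x)^T = A x /\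
    forall xi : 'cV[R]_d,
      a0 * enorm xi ^+ 2 <= dotv xi (A x *m xi) <= a1 * enorm xi ^+ 2}.

(* The symmetric positive semidefinite square root. *)
Definition mxsqrt (M : 'M[R]_d) : 'M[R]_d :=
  xget 0 [set S : 'M[R]_d |
    [/\ S^T = S, forall xi : 'cV[R]_d, 0 <= dotv xi (S *m xi)
      & S *m S = M]].

Definition bilin (A : 'cV[R]_d -> 'M[R]_d) (b : 'cV[R]_d -> 'cV[R]_d)
    (c : 'cV[R]_d -> R) (t s : H1 Omega) : R :=
  ipv Omega (fun x => A x *m h1grad t x) (h1grad s) +
  ips Omega (fun x => dotv (b x) (h1grad t x) + c x * t x) s.

(* l(s), where g is the trace of s *)
Definition linform (f1 : 'cV[R]_d -> R) (f2 : 'cV[R]_d -> 'cV[R]_d)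
    (psi : 'cV[R]_d -> R) (s : H1 Omega) (g : 'cV[R]_d -> R) : R :=
  ips Omega f1 s - ipv Omega f2 (h1grad s) - ipb GammaN psi g.

Definition H1D_nonzero : set (H1 Omega) :=
  [set v | H1D GammaD v /\ ~ {ae Leb R d, forall x, Omega x -> v x = 0}].

Definition inf_sup (A : 'cV[R]_d -> 'M[R]_d) (b : 'cV[R]_d -> 'cV[R]_d)
    (c : 'cV[R]_d -> R) (beta : R) : Prop :=
  beta%:E = ereal_inf [set ereal_sup
      [set (bilin A b c w v / (norm1 w * norm1 v))%:E | v in H1D_nonzero]
    | w in H1D_nonzero] /\
  beta%:E = ereal_inf [set ereal_sup
      [set (bilin A b c w v / (norm1 w * norm1 v))%:E | w in H1D_nonzero]
    | v in H1D_nonzero].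

Definition primal_solution (A : 'cV[R]_d -> 'M[R]_d)
    (b : 'cV[R]_d -> 'cV[R]_d) (c : 'cV[R]_d -> R)
    (f1 : 'cV[R]_d -> R) (f2 : 'cV[R]_d -> 'cV[R]_d)
    (psi phi : 'cV[R]_d -> R) (u : H1 Omega) : Prop :=
  trace_eq_on GammaD u phi /\
  forall s0 : H1 Omega, H1D GammaD s0 -> forall g, is_trace s0 g ->
    bilin A b c u s0 = linform f1 f2 psi s0 g.

Definition etaLS (A : 'cV[R]_d -> 'M[R]_d) (b : 'cV[R]_d -> 'cV[R]_d)
    (c : 'cV[R]_d -> R) (f1 : 'cV[R]_d -> R) (f2 : 'cV[R]_d -> 'cV[R]_d)
    (tau : Hdiv Omega) (w : H1 Omega) : R :=
  let Ah x := mxsqrt (A x) in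
  let Aih x := invmx (mxsqrt (A x)) in
  let r1 x := Aih x *m tau x + Ah x *m h1grad w x + Aih x *m f2 x in
  let r2 x := hdivdiv tau x + dotv (b x) (h1grad w x) + c x * w x - f1 x in
  Num.sqrt (ipv Omega r1 r1 + ips Omega r2 r2).

End problem.

(* Main.v *)
(* The errors E = (sigma - tau, div sigma - div tau) and e = u - w determine the
   residual: with L e = (A grad e, b . grad e + c e), the pair Z of the residual
   A^{1/2} r_1 and of r_2 is -(E + L e), because the primal problem makes
   div sigma = f_1 - b . grad u - c u.  As L is bounded and A is uniformly
   elliptic, the upper estimate is the triangle inequality.  For the lower one,
   sigma and tau have the same normal trace on Gamma_N, so E is orthogonal to
   (grad v, v) for every v in H^1_D, and a(e, v) = -(Z, (grad v, v)).  The inf-sup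
   condition then bounds |e|_1 by |Z| / beta, and E = -(Z + L e).

   That sigma has a weak divergence is the primal problem tested with smooth
   functions of compact support in Omega; these belong to H^1_D because
   integration by parts holds for Lebesgue measure, which is translation
   invariant. *)
Require Import Defs.
From HB Require Import structures.
From mathcomp Require Import all_boot all_order all_algebra.
From mathcomp Require Import all_classical all_reals all_analysis.
From mathcomp Require Import measurable_realfun.
From mathcomp Require Import complex.
From mathcomp Require Import ring lra.

Set Implicit Arguments.
Unset Strict Implicit.
Unset Printing Implicit Defensive.

Import Order.TTheory GRing.Theory Num.Theory.
Import numFieldNormedType.Exports.
Local Open Scope classical_set_scope.
Local Open Scope ring_scope.

(** The substitution z = A^{1/2} r_1 = tau + f_2 + A grad w removes the square root: |z|^2 = r_1 . A
    r_1 lies between a0 |r_1|^2 and a1 |r_1|^2, and z involves only bounded coefficients. The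
    estimator is thus comparable to |Z|, and the components of Z pair with grad v and v exactly as
    the form a does. Three obstacles shape the rest. Functions are representatives, not classes, so
    the inner product on pairs is only semidefinite, and bilinearity is available only for square
    integrable pairs. The infimum in the inf-sup condition skips every function that is zero almost
    everywhere, and e may be one. Both measures come from gauges on arbitrary sets, so even the
    measurability of half-spaces has to be drawn from Caratheodory's criterion: by cutting boxes for
    Lebesgue measure, by the separation of sets of small diameter for surface measure. *)

Local Notation lebT R d := (caratheodory_type (@lebesgue_outer_measure R d)).
Local Notation surfT R d := (caratheodory_type (@hausdorff_outer_measure R d.-1 d)).

(** * Euclidean vectors and positive semidefinite matrices *)

Section dotv.
Context (R : realType) (d : nat).
Implicit Types (x y z : 'cV[R]_d) (M : 'M[R]_d).

Lemma dotvE x y : dotv x y = (x^T *m y) 0 0.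
Proof. by rewrite mxE; apply: eq_bigr => i _; rewrite mxE. Qed.

Lemma dotvC x y : dotv x y = dotv y x.
Proof. by apply: eq_bigr => i _; rewrite mulrC. Qed.

Lemma dotvDl x y z : dotv (x + y) z = dotv x z + dotv y z.
Proof. by rewrite !dotvE linearD/= mulmxDl mxE. Qed.

Lemma dotvZl (a : R) x z : dotv (a *: x) z = a * dotv x z.
Proof. by rewrite !dotvE linearZ/= -scalemxAl mxE. Qed.

Lemma dotvNl x z : dotv (- x) z = - dotv x z.
Proof. by rewrite -scaleN1r dotvZl mulN1r. Qed.

Lemma dotvDr x y z : dotv z (x + y) = dotv z x + dotv z y.
Proof. by rewrite dotvC dotvDl !(dotvC z). Qed.

Lemma dotvZr (a : R) x z : dotv z (a *: x) = a * dotv z x.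
Proof. by rewrite dotvC dotvZl dotvC. Qed.

Lemma dotv_ge0 x : 0 <= dotv x x.
Proof. by apply: sumr_ge0 => i _; rewrite -expr2 sqr_ge0. Qed.

Lemma dotv_eq0 x : dotv x x = 0 -> x = 0.
Proof.
move=> /eqP; rewrite psumr_eq0; last by move=> i _; rewrite -expr2 sqr_ge0.
move=> /allP x0; apply/matrixP => i j; rewrite ord1 mxE.
by apply/eqP; have := x0 i (mem_index_enum _); rewrite -expr2 sqrf_eq0.
Qed.

Lemma dotv_sym M x y : M^T = M -> dotv x (M *m y) = dotv (M *m x) y.
Proof. by move=> Ms; rewrite !dotvE trmx_mul Ms mulmxA. Qed.

Lemma enorm_sqr x : enorm x ^+ 2 = dotv x x.
Proof. by rewrite sqr_sqrtr// dotv_ge0. Qed.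

End dotv.

(** Newton's scheme: a new node [a] is matched by adding a multiple of the product [q], which
    vanishes at all earlier nodes but not at [a]. *)
Lemma interpolation (R : fieldType) (s : seq R) (f : R -> R) :
  exists p : {poly R}, forall x, x \in s -> p.[x] = f x.
Proof.
elim: s => [|a s [p pf]]; first by exists 0.
have [aS|aS] := boolP (a \in s).
  by exists p => x; rewrite inE => /predU1P[->|]; exact: pf.
pose q := \prod_(b <- s) ('X - b%:P).
have qa : q.[a] != 0.
  by rewrite -rootE root_prod_XsubC.
exists (p + ((f a - p.[a]) / q.[a])%:P * q) => x.
rewrite inE !hornerE => /predU1P[->|xs]; first by rewrite divfK// addrC subrK.
have /rootP -> : root q x by rewrite root_prod_XsubC.
by rewrite mulr0 addr0 pf.
Qed.

(* T = q(M) for a real polynomial q with q(l) ^ 4 = l at the eigenvalues l of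
   M; then T ^ 2 is positive semidefinite because T is symmetric. *)
Lemma psd_sqrt (R : realType) (n : nat) (M : 'M[R]_n) :
    M^T = M -> (forall x : 'cV[R]_n, 0 <= dotv x (M *m x)) ->
  exists S : 'M[R]_n,
    [/\ S^T = S, forall x : 'cV[R]_n, 0 <= dotv x (S *m x) & S *m S = M].
Proof.
case: n M => [|n] M Msym Mpos.
  exists 0; split => //; first by rewrite trmx0.
  - by move=> x; rewrite mul0mx dotvE mulmx0 mxE.
  - by apply/matrixP => -[].
(* The spectral theorem is applied over the complex numbers: [M] is real symmetric, so [MC] is
   Hermitian and its eigenvalues come from reals [l i]. *)
pose C : numClosedFieldType := complex R.
pose f : {rmorphism R -> C} := real_complex_def (Phant R).
pose MC : 'M[C]_n.+1 := map_mx f M.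
have MCherm : MC \is hermsymmx.
  apply: realsym_hermsym.
    by apply/is_hermitianmxP; rewrite /= expr0 scale1r map_mx_id// /MC map_trmx Msym.
  by apply/mxOverP => i j; rewrite mxE; apply/complex_realP; exists (M i j).
have MCdiag := orthomx_spectralP (hermitian_normalmx MCherm).
set P := spectralmx MC in MCdiag; set D := spectral_diag MC in MCdiag.
have Punit : P \in unitmx by exact: spectral_unit.
have /mxOverP Dreal := hermitian_spectral_diag_real MCherm.
have /choice[l Dl] : forall i, exists k, D 0 i = f k.
  by move=> i; exact/complex_realP/Dreal.
have l_ge0 i : 0 <= l i.
  have : eigenvalue MC (f (l i)).
    apply/eigenvalueP; exists (row i P).
      rewrite -row_mul [X in P *m X]MCdiag !mulmxA mulmxV// mul1mx.
      by rewrite row_mul row_diag_mx -scalemxAl -rowE -Dl.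
    apply/negP => /eqP /(congr1 (mulmx^~ (invmx P))).
    rewrite rowE mulmxK// mul0mx => /matrixP/(_ 0 i).
    by rewrite !mxE !eqxx => /eqP; rewrite oner_eq0.
  (* A real eigenvalue of [MC] is one of [M], with a real eigenvector [v]; there the quadratic form
     equals [l i] times |v|^2. *)
  rewrite eigenvalue_map => /eigenvalueP[v vM v0].
  have := Mpos v^T.
  rewrite dotv_sym// -[M in M *m _]trmxK -trmx_mul Msym vM linearZ/= dotvZl.
  rewrite pmulr_lge0// lt_neqAle dotv_ge0 andbT eq_sym.
  apply: contra_neq v0 => /dotv_eq0 /(congr1 trmx).
  by rewrite trmxK trmx0.
have [q qP] := interpolation [seq l i | i : 'I_n.+1] (fun x => Num.sqrt (Num.sqrt x)).
pose T := horner_mx M q.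
have T4 : T *m T *m (T *m T) = M.
  suff : horner_mx M (q ^+ 4 - 'X) = 0.
    rewrite rmorphB rmorphXn/= horner_mx_X => /eqP; rewrite subr_eq0 => /eqP <-.
    by rewrite -/T (exprD _ 2 2) expr2.
  apply: (@map_mx_inj _ _ f); rewrite map_horner_mx map_mx0 -/MC MCdiag.
  rewrite horner_mx_uconjC// horner_mx_diag.
  suff -> : map_mx (horner (map_poly f (q ^+ 4 - 'X))) D = 0.
    by rewrite linear0 mulmx0 mul0mx.
  apply/matrixP => i j; rewrite !mxE ord1 Dl horner_map/= !hornerE.
  rewrite qP; last by rewrite map_f// mem_enum.
  by rewrite (exprM _ 2 2) !sqr_sqrtr ?sqrtr_ge0// subrr rmorph0.
have Tsym : T^T = T.
  rewrite /T; elim/poly_ind: {qP T T4} q => [|p a IH]; first by rewrite rmorph0 trmx0.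
  rewrite rmorphD rmorphM/= horner_mx_X horner_mx_C linearD/= tr_scalar_mx.
  congr (_ + _); rewrite trmx_mul Msym IH.
  by have := comm_horner_mx2 M 'X p; rewrite horner_mx_X.
exists (T *m T); split => //; first by rewrite trmx_mul Tsym.
by move=> x; rewrite -mulmxA dotv_sym// dotv_ge0.
Qed.

(** * Borel sets are measurable for Lebesgue and Hausdorff measure *)

Section outer_measures.
Context (R : realType).
Local Open Scope ereal_scope.

(** A cover of A and B together is turned into one of A and one of B by splitting each of its
    members at no extra cost. For Lebesgue measure a hyperplane cuts the boxes; for Hausdorff
    measure a small set meets only one of two separated sets. *)
Lemma cover_outer_split (T : pointedType) (zeta : set T -> \bar R) (A B : set T) :
    (forall U, 0 <= zeta U) ->
    (forall U, exists U1 U2, [/\ U `&` A `<=` U1, U `&` B `<=` U2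
                               & zeta U1 + zeta U2 <= zeta U]) ->
  cover_outer zeta A + cover_outer zeta B <= cover_outer zeta (A `|` B).
Proof.
move=> z0 /choice[U1 /choice[U2 H]]; apply: le_ereal_inf_tmp => _ [U /= UAB <-].
apply: (@le_trans _ _
    (\sum_(k <oo) zeta (U1 (U k)) + \sum_(k <oo) zeta (U2 (U k)))).
  apply: leeD; apply: ereal_inf_lbound => /=.
  - exists (U1 \o U) => // x Ax; have [k _ Ukx] := UAB x (or_introl Ax).
    by exists k => //; have [+ _ _] := H (U k); apply.
  - exists (U2 \o U) => // x Ax; have [k _ Ukx] := UAB x (or_intror Ax).
    by exists k => //; have [_ + _] := H (U k); apply.
rewrite -nneseriesD//; apply: lee_nneseries => k _.
- by move=> _; rewrite adde_ge0.
- by have [] := H (U k).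
Qed.

(* Caratheodory's criterion: X `&` {f < a} is exhausted by the sets
   X `&` {f <= t_n}, t_n increasing to a, and the shells between them carry a
   convergent series because every second shell is separated from the
   previous ones. *)
Lemma metric_caratheodory (T : pointedType) (mu : {outer_measure set T -> \bar R})
    (f : T -> R) (a : R) :
    (forall (r s : R) A B, (r < s)%R -> (forall x, A x -> (f x <= r)%R) ->
      (forall x, B x -> (s <= f x)%R) -> mu A + mu B <= mu (A `|` B)) ->
  mu.-caratheodory [set x | (f x < a)%R].
Proof.
move=> sep; apply: le_caratheodory_measurable => X.
have [->|Xoo] := eqVneq (mu X) +oo; first by rewrite leey.
have Xlt : mu X < +oo by rewrite ltey.
pose t n : R := (a - n.+1%:R^-1)%R.
have tS n : (t n < t n.+1)%R by rewrite ltrD2l ltrN2 ltf_pV2 ?posrE// ltr_nat.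
have ta n : (t n < a)%R by rewrite ltrBlDr ltrDl.
pose H n := X `&` [set x | (f x <= t n)%R].
pose S n := X `&` [set x | (t n.+1 < f x <= t n.+2)%R].
have HX n : mu (H n) <= mu X by apply: le_outer_measure => x [].
(* [H n] and [S n] are separated by the gap from [t n] to [t n.+1], so the sum of their measures is
   at most that of [H n.+2]. Keeping two consecutive [H] in the bound lets each induction step spend
   the older one. *)
have sumS n : \sum_(0 <= k < n) mu (S k) <= mu (H n) + mu (H n.+1).
  elim: n => [|n IH]; first by rewrite big_geq// adde_ge0.
  rewrite big_nat_recr//= (le_trans (leeD2r _ IH))//.
  rewrite -addeAC addeC leeD2l//.
  apply: (@le_trans _ _ (mu (H n `|` S n))).
    apply: (sep (t n) (t n.+1)) => //; first by move=> x [].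
    by move=> x [_ /andP[/ltW]].
  apply: le_outer_measure => x [[Xx /= fx]|[Xx /= /andP[]//]].
  split => //=; apply: (le_trans fx); apply: ltW; exact: lt_trans (tS _).
have Sfin : \sum_(0 <= k <oo) mu (S k) < +oo.
  apply: (@le_lt_trans _ _ (mu X + mu X)); last exact: lte_add_pinfty.
  apply: lime_le; first exact: is_cvg_nneseries.
  by apply: nearW => n; rewrite (le_trans (sumS n))// leeD.
have tail0 := nneseries_tail_cvg Sfin (fun k _ => outer_measure_ge0 mu (S k)).
have main n : mu (X `&` [set x | (f x < a)%R]) + mu (X `&` ~` [set x | (f x < a)%R])
    <= mu X + \sum_(n <= k <oo) mu (S k).
  have H1 : mu (H n.+1) + mu (X `&` ~` [set x | (f x < a)%R]) <= mu X.
    apply: le_trans (_ : mu (H n.+1 `|` (X `&` ~` [set x | (f x < a)%R])) <= _).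
      apply: (sep (t n.+1) a) => //; first by move=> x [].
      by move=> x [_ /negP]; rewrite -leNgt.
    by apply: le_outer_measure => x [[]|[]].
  apply: le_trans (leeD2r _ H1); rewrite addeAC leeD2r//.
  apply: (@le_trans _ _ (mu (H n.+1 `|` \bigcup_(k in ~` `I_n) S k))).
    apply: le_outer_measure => x [Xx /= fxa].
    have [ft|tf] := leP (f x) (t n.+1); first by left.
    right; have [m tm] : exists m, (f x <= t m)%R.
      have fa : (0 < a - f x)%R by rewrite subr_gt0.
      have [m _ mP] := near_infty_natSinv_lt (PosNum fa).
      exists m; rewrite lerBrDr -lerBrDl; exact/ltW/(mP m)/leqnn.
    (* The least j with f x <= t j is at least n + 2, and minimality places x in the shell of index
       j - 2, which is at least n. *)
    have [j jP jmin] := ex_minnP (ex_intro (fun m => (f x <= t m)%R) m tm).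
    have nj : (n.+1 < j)%N.
      rewrite ltnNge; apply/negP => jn.
      suff : (f x <= t n.+1)%R by rewrite leNgt tf.
      apply: (le_trans jP); elim: {+}(n.+1) jn {tf} => [|k IH].
        by rewrite leqn0 => /eqP ->.
      rewrite leq_eqVlt => /predU1P[->//|mk].
      by apply: le_trans (IH mk) _; exact/ltW/tS.
    case: j nj jP jmin => [//|[//|j]] nj jP jmin.
    exists j; first by apply/negP; rewrite -leqNgt.
    split => //=; rewrite jP andbT ltNge; apply/negP => /jmin.
    by rewrite ltnn.
  apply: (le_trans (outer_measureU2 mu _ _)).
  by rewrite leeD2l//; exact: outer_measure_sigma_subadditive_tail.
have lim : mu X + \sum_(n <= k <oo) mu (S k) @[n --> \oo] --> mu X + 0.
  apply: cvgeD => //; first by rewrite fin_num_adde_defl.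
  exact: cvg_cst.
rewrite adde0 in lim.
rewrite -(cvg_lim _ lim)//; apply: lime_ge; first by apply/cvg_ex; exists (mu X).
exact: nearW.
Qed.

End outer_measures.

Section euclidean_outer_measures.
Context (R : realType) (d : nat).
Implicit Types U : set 'cV[R]_d.

(** An open set is the countable union of the open cubes with rational centre and radius that it
    contains. A cube is a finite intersection of slabs; the strict lower bound of a slab is a
    countable union of complements of half-spaces. *)
Lemma open_caratheodory (mu : {outer_measure set 'cV[R]_d -> \bar R}) :
    (forall i a, mu.-caratheodory [set x : 'cV[R]_d | x i 0 < a]) ->
  forall U, open U -> mu.-caratheodory U.
Proof.
move=> hs U oU.
have hsm (i : 'I_d) a : mu.-cara.-measurable [set x : 'cV[R]_d | x i 0 < a].
  exact: hs.
pose C (p : 'cV[rat]_d * rat) : set 'cV[R]_d :=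
  [set x | forall i, `|x i 0 - ratr (p.1 i 0)| < ratr p.2].
have mC p : mu.-cara.-measurable (C p).
  have -> : C p = \bigcap_(i in [set: 'I_d])
     ([set x : 'cV[R]_d | x i 0 < ratr (p.1 i 0) + ratr p.2] `&`
      \bigcup_(n in [set: nat])
        ~` [set x : 'cV[R]_d | x i 0 < ratr (p.1 i 0) - ratr p.2 + n.+1%:R^-1]).
    apply/seteqP; split => x /=.
      move=> xC i _; have /= := xC i; rewrite ltr_distl => /andP[x1 x2]; split => //.
      have x0 : 0 < x i 0 - (ratr (p.1 i 0) - ratr p.2) by rewrite subr_gt0.
      have [m _ mP] := near_infty_natSinv_lt (PosNum x0).
      exists m => //=; apply/negP; rewrite -leNgt -lerBrDl.
      exact/ltW/(mP m)/leqnn.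
    move=> H i; have [/= x1 [n _ /= /negP]] := H i I; rewrite -leNgt => x2.
    rewrite ltr_distl x1 andbT (lt_le_trans _ x2)//.
    by rewrite ltrDl.
  apply: fin_bigcap_measurable => // i _; apply: measurableI; first exact: hsm.
  by apply: bigcup_measurable => n _; exact/measurableC/hsm.
have -> : U = \bigcup_p (if `[< C p `<=` U >] then C p else set0).
  apply/seteqP; split => x; last first.
    by move=> [p _]; case: asboolP => // + /[dup] => pU Cp /pU.
  move=> Ux; have /nbhs_ballP[e /= e0 eU] := open_nbhs_nbhs (conj oU Ux).
  have [r /[!in_itv]/= /andP[r0 re]] : exists r : rat, ratr r \in `]0, e / 2[.
    by apply: rat_in_itvoo; rewrite divr_gt0.
  have /choice[q qP] : forall i : 'I_d, exists q, `|x i 0 - ratr q| < ratr r.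
    move=> i; have [q] := @rat_in_itvoo R (x i 0 - ratr r) (x i 0 + ratr r)
          ltac:(lra).
      rewrite in_itv/= => /andP[q1 q2]; exists q; rewrite ltr_distl; lra.
  exists (\col_i q i, r) => //; case: asboolP => [_|[]].
    by move=> i /=; rewrite mxE.
  move=> y yC; apply: eU; split => // i j; rewrite ord1.
  rewrite /ball/= (le_lt_trans (ler_distD (ratr (q i)) _ _))//.
  rewrite [e]splitr ltrD// (lt_trans _ re)//.
  by rewrite distrC; have := yC i; rewrite /= mxE.
apply: (@countable_bigcupT_measurable _ (caratheodory_type mu)).
  exact: countableP.
by move=> p; case: ifP => // _; exact: mC.
Qed.

Lemma le_box_volume (p q : 'cV[R]_d) : (forall i, p i 0 <= q i 0) ->
  (box_volume (box p q) <= (\prod_(i < d) (q i 0 - p i 0))%:E)%E.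
Proof.
move=> pq; rewrite /box_volume; case: ifPn => _.
  by rewrite lee_fin prodr_ge0// => i _; rewrite subr_ge0.
by apply: ereal_inf_lbound; exists (p, q).
Qed.

(** The hyperplane x_i = a cuts a box into two closed boxes whose volumes add up to the original
    one, or misses it and leaves one part empty. The halves are taken closed because the gauge is
    finite on closed boxes only; their common face does no harm in a cover. *)
Lemma lebesgue_half_space (i : 'I_d) a :
  (@lebesgue_outer_measure R d).-caratheodory [set x : 'cV[R]_d | x i 0 < a].
Proof.
apply: le_caratheodory_measurable => X.
set H := [set x | _].
apply: (@le_trans _ _ (lebesgue_outer ((X `&` H) `|` (X `&` ~` H)))); last first.
  by apply: le_outer_measure => x [[]|[]].
apply: cover_outer_split; first exact: box_volume_ge0.
move=> U; exists (U `&` [set x | x i 0 <= a]), (U `&` [set x | a <= x i 0]); split.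
- by move=> x [Ux [_ xH]]; split => //; exact: ltW.
- by move=> x [Ux [_ /negP xH]]; split => //=; rewrite leNgt.
have [->|U0] := eqVneq U set0; first by rewrite !set0I box_volume0 adde0.
rewrite [leRHS]/box_volume (negbTE U0).
apply: le_ereal_inf_tmp => _ [[p q] /= Upq <-].
have [x0 Ux0] : U !=set0 by exact/set0P.
have pq j : p j 0 <= q j 0.
  by move: Ux0; rewrite Upq => /(_ j)/andP[]; exact: le_trans.
have [ap|pa] := ltP a (p i 0).
  rewrite (_ : U `&` _ = set0) ?box_volume0 ?add0e; last first.
    rewrite Upq; apply/seteqP; split => x //= -[/(_ i)/andP[pix _]].
    by rewrite leNgt (lt_le_trans ap).
  rewrite (_ : U `&` _ = box p q); first exact: le_box_volume.
  rewrite Upq; apply/seteqP; split => x /=; first by case.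
  by move=> xU; split => //; have /andP[/(le_trans (ltW ap))] := xU i.
have [qa|aq] := ltP (q i 0) a.
  rewrite addeC (_ : U `&` _ = set0) ?box_volume0 ?add0e; last first.
    rewrite Upq; apply/seteqP; split => x //= -[/(_ i)/andP[_ pix]].
    by rewrite leNgt (le_lt_trans pix).
  rewrite (_ : U `&` _ = box p q); first exact: le_box_volume.
  rewrite Upq; apply/seteqP; split => x /=; first by case.
  by move=> xU; split => //; have /andP[_ /le_trans->//] := xU i; exact: ltW.
pose q' : 'cV[R]_d := \col_j if j == i then a else q j 0.
pose p' : 'cV[R]_d := \col_j if j == i then a else p j 0.
rewrite (_ : U `&` _ = box p q'); last first.
  rewrite Upq; apply/seteqP; split => x /=.
    move=> [xU xa] j; rewrite mxE.
    by case: eqP => [->|_]; rewrite ?xa ?andbT; case/andP: (xU i) (xU j).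
  move=> xU; split; last by have := xU i; rewrite mxE eqxx => /andP[].
  move=> j; have := xU j; rewrite mxE; case: eqP => [->|//] /andP[-> /le_trans]; exact.
rewrite (_ : U `&` _ = box p' q); last first.
  rewrite Upq; apply/seteqP; split => x /=.
    move=> [xU xa] j; rewrite mxE.
    by case: eqP => [->|_]; rewrite ?xa /=; case/andP: (xU i) (xU j).
  move=> xU; split; last by have := xU i; rewrite mxE eqxx => /andP[].
  move=> j; have := xU j; rewrite mxE; case: eqP => [->|//] /andP[ax ->].
  by rewrite (le_trans pa).
apply: (@le_trans _ _ ((\prod_(j < d) (q' j 0 - p j 0))%:E +
    (\prod_(j < d) (q j 0 - p' j 0))%:E)%E).
  by apply: leeD; apply: le_box_volume => j; rewrite mxE; case: eqP => // ->.
rewrite -EFinD lee_fin (bigD1 i)//= [X in _ + X](bigD1 i)//= [leRHS](bigD1 i)//=.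
rewrite (eq_bigr (fun j => q j 0 - p j 0)); last by move=> j /negbTE ji; rewrite mxE ji.
rewrite [X in _ + _ * X](eq_bigr (fun j => q j 0 - p j 0)); last first.
  by move=> j /negbTE ji; rewrite mxE ji.
by rewrite !mxE eqxx -mulrDl addrC addrA subrK.
Qed.

Lemma ler_abs_enorm (x : 'cV[R]_d) i : `|x i 0| <= enorm x.
Proof.
rewrite -sqrtr_sqr ler_wsqrtr// /dotv (bigD1 i)//= expr2 lerDl.
by apply: sumr_ge0 => j _; rewrite -expr2 sqr_ge0.
Qed.

Section separated_sets.
Local Open Scope ereal_scope.

(** A set of diameter less than s - r cannot meet both A and B, since a difference of coordinates is
    at most the Euclidean distance. Hence covers by such sets split without loss, and the supremum
    over delta only sees small delta. *)
Lemma hausdorff_separated m i r s (A B : set 'cV[R]_d) : (r < s)%R ->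
    (forall x, A x -> (x i ord0 <= r)%R) -> (forall x, B x -> (s <= x i ord0)%R) ->
  hausdorff_outer m A + hausdorff_outer m B <= hausdorff_outer m (A `|` B).
Proof.
move=> rs Ar Bs.
have mono (d1 d2 : R) C : (d2 <= d1)%R ->
    cover_outer (hausdorff_gauge m d1) C <= cover_outer (hausdorff_gauge m d2) C.
  move=> d21; apply: le_ereal_inf_tmp => _ [U UC <-].
  apply: (@le_trans _ _ (\sum_(k <oo) hausdorff_gauge m d1 (U k))).
    by apply: ereal_inf_lbound; exists U.
  apply: lee_nneseries => k _; first by move=> _; exact: hausdorff_gauge_ge0.
  rewrite /hausdorff_gauge; case: ifP => // _.
  case: (leP (ediam _) d2%:E) => [Ud2|]; last by rewrite leey.
  by rewrite (le_trans Ud2)// lee_fin.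
have split (e : R) : (e < s - r)%R ->
    cover_outer (hausdorff_gauge m e) A + cover_outer (hausdorff_gauge m e) B <=
    cover_outer (hausdorff_gauge m e) (A `|` B).
  move=> ers; apply: cover_outer_split; first exact: hausdorff_gauge_ge0.
  move=> U; have [UA|/set0P[x [Ux Ax]]] := eqVneq (U `&` A) set0.
    exists set0, U; split => //; first by rewrite UA.
    by rewrite hausdorff_gauge0 add0e.
  have [UB|/set0P[y [Uy By]]] := eqVneq (U `&` B) set0.
    exists U, set0; split => //; first by rewrite UB.
    by rewrite hausdorff_gauge0 adde0.
  exists U, U; split => //.
  rewrite [leRHS]/hausdorff_gauge; case: ifPn => [/eqP U0|_].
    by move: Ux; rewrite U0.
  case: (leP (ediam U) e%:E) => [|_]; last by rewrite leey.
  rewrite leNgt => /negP[]; apply: (@lt_le_trans _ _ (enorm (y - x))%:E).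
    rewrite lte_fin (lt_le_trans ers)// (le_trans _ (ler_abs_enorm _ i))// !mxE.
    by rewrite (le_trans _ (ler_norm _))// lerB// ?Ar ?Bs.
  by apply: ereal_sup_ubound; exists (y, x).
(* The two suprema run over independent scales; by monotonicity both scales may be replaced by a
   common smaller one, below the gap. *)
have bound (d1 d2 : R) : (0 < d1)%R -> (0 < d2)%R ->
    cover_outer (hausdorff_gauge m d1) A + cover_outer (hausdorff_gauge m d2) B <=
    hausdorff_outer m (A `|` B).
  move=> d10 d20; pose e := Num.min (Num.min d1 d2) ((s - r) / 2)%R.
  have sr : (0 < s - r)%R by rewrite subr_gt0.
  apply: (@le_trans _ _ (cover_outer (hausdorff_gauge m e) (A `|` B))).
    apply: le_trans (split e _).
      by apply: leeD; apply: mono; rewrite /e !ge_min lexx ?orbT.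
    by rewrite gt_min; apply/orP; right; rewrite ltr_pdivrMr// ltr_pMr// ltr1n.
  apply: ereal_sup_ubound; exists e => //=.
  by rewrite !lt_min d10 d20 divr_gt0.
have [->|Hoo] := eqVneq (hausdorff_outer m (A `|` B)) +oo; first by rewrite leey.
have Hfin C : C `<=` A `|` B -> hausdorff_outer m C \is a fin_num.
  move=> CAB; rewrite ge0_fin_numE ?hausdorff_outer_ge0//.
  by apply: (@le_lt_trans _ _ _ _ _ (@le_hausdorff_outer R m d C _ CAB)); rewrite ltey.
(* All terms are finite now, so each supremum can be isolated by subtraction and tested at a single
   scale. *)
rewrite -leeBrDr ?Hfin//; apply: ge_ereal_sup => _ [d1 /= d10 <-].
rewrite leeBrDr ?Hfin//.
have Cfin : cover_outer (hausdorff_gauge m d1) A \is a fin_num.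
  rewrite ge0_fin_numE; last exact/cover_outer_ge0/hausdorff_gauge_ge0.
  apply: le_lt_trans (_ : hausdorff_outer m A < +oo).
    by apply: ereal_sup_ubound; exists d1.
  by rewrite ltey_eq Hfin.
rewrite addeC -leeBrDr//; apply: ge_ereal_sup => _ [d2 /= d20 <-].
by rewrite leeBrDr// addeC bound.
Qed.

End separated_sets.

Lemma hausdorff_half_space m (i : 'I_d) a :
  (@hausdorff_outer_measure R m d).-caratheodory [set x : 'cV[R]_d | x i 0 < a].
Proof.
apply: (metric_caratheodory (f := fun x : 'cV[R]_d => x i 0)) => r s A B.
exact: hausdorff_separated.
Qed.

End euclidean_outer_measures.

Section measurability.
Context (R : realType) (d : nat).
Implicit Types U D : set 'cV[R]_d.

Section caratheodory.
Variable mu : {outer_measure set 'cV[R]_d -> \bar R}.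
Hypothesis hs : forall i a, mu.-caratheodory [set x : 'cV[R]_d | x i 0 < a].

Lemma continuous_caratheodory (f : 'cV[R]_d -> R) (D : set (caratheodory_type mu)) :
  continuous f -> measurable_fun D (f : caratheodory_type mu -> R).
Proof.
move=> cf; apply: (@measurable_funS _ _ (caratheodory_type mu) R setT) => //.
apply: (measurability (measurable_realfun.RGenOInfty.G (R:=R))).
  exact: measurable_realfun.RGenOInfty.measurableE.
move=> _ [_ [x ->] <-]; rewrite setTI.
apply: (open_caratheodory hs); apply: open_comp; last exact: interval_open.
by move=> y _; exact: cf.
Qed.

End caratheodory.

Lemma Leb_open U : open U -> measurable (U : set (lebT R d)).
Proof. exact/open_caratheodory/lebesgue_half_space. Qed.

Lemma Leb_continuous (f : 'cV[R]_d -> R) (D : set (lebT R d)) : continuous f ->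
  measurable_fun D (f : lebT R d -> R).
Proof. exact/continuous_caratheodory/lebesgue_half_space. Qed.

Lemma Surf_open U : open U ->
  measurable (U : set (surfT R d)).
Proof. exact/open_caratheodory/hausdorff_half_space. Qed.

Lemma Surf_continuous (f : 'cV[R]_d -> R) (D : set (surfT R d)) : continuous f ->
  measurable_fun D (f : surfT R d -> R).
Proof. exact/continuous_caratheodory/hausdorff_half_space. Qed.

Lemma Surf_bdry U :
  measurable (bdry U : set (surfT R d)).
Proof.
apply: measurableD; last exact/Surf_open/open_interior.
rewrite -[X in measurable X]setCK; apply: measurableC; apply: Surf_open.
by rewrite openC; exact: closed_closure.
Qed.

Lemma ler_coord_norm (x : 'cV[R]_d) i : `|x i 0| <= `|x|.
Proof.
rewrite -[leRHS]/(mx_norm x) mx_normrE.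
exact: (le_bigmax _ (fun i => `|x i.1 i.2|) (i, 0)).
Qed.

Lemma Leb_bounded_set U : bounded_set U -> (lebesgue_outer U < +oo)%E.
Proof.
move=> [M [Mr /(_ (`|M| + 1))]].
rewrite (le_lt_trans (ler_norm _)) ?ltrDl// => /(_ isT) HM.
set r : R := `|M| + 1 in HM.
have r0 : 0 <= r by rewrite addr_ge0.
pose Q : set 'cV[R]_d := box (const_mx (- r)) (const_mx r).
apply: (@le_lt_trans _ _ (box_volume Q)).
  apply: ereal_inf_lbound => /=.
  exists (fun k : nat => match k return set 'cV[R]_d with 0%N => Q | _ => set0 end).
    move=> x Ux; exists 0%N => // i; rewrite !mxE -ler_norml.
    exact: le_trans (ler_coord_norm _ _) (HM x Ux).
  rewrite nneseries_recl//; last by move=> k _; exact: box_volume_ge0.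
  rewrite eseries0 ?adde0// => -[|k]//= _ _; exact: box_volume0.
apply: (le_lt_trans (le_box_volume _)); last by rewrite ltry.
by move=> i; rewrite !mxE; rewrite ge0_cp.
Qed.

End measurability.

(** * Translation invariance of Lebesgue measure *)

Section translation.
Context (R : realType) (d : nat).
Implicit Types A U : set 'cV[R]_d.

Lemma box_volume_shift (v : 'cV[R]_d) U :
  (box_volume ((+%R^~ v) @^-1` U) <= box_volume U)%E.
Proof.
rewrite {2}/box_volume; case: ifPn => [/eqP ->|U0].
  by rewrite preimage_set0 box_volume0.
apply: le_ereal_inf_tmp => _ [[p q] /= Upq <-].
rewrite (_ : _ @^-1` _ = box (p - v) (q - v)); last first.
  rewrite Upq; apply/seteqP; split => x /= xU i; have := xU i; rewrite !mxE.
    by rewrite lerBlDr lerBrDr.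
  by rewrite lerBlDr lerBrDr.
have [x0 Ux0] : U !=set0 by exact/set0P.
apply: (le_trans (le_box_volume _)) => [i|].
  by rewrite !mxE lerD2r; move: Ux0; rewrite Upq => /(_ i)/andP[]; exact: le_trans.
rewrite lee_fin le_eqVlt; apply/orP; left; apply/eqP/eq_bigr => i _.
by rewrite !mxE opprB addrA subrK.
Qed.

Lemma lebesgue_outer_shift (v : 'cV[R]_d) A :
  lebesgue_outer ((+%R^~ v) @^-1` A) = lebesgue_outer A.
Proof.
have le (w : 'cV[R]_d) (B : set 'cV[R]_d) :
    (lebesgue_outer ((+%R^~ w) @^-1` B) <= lebesgue_outer B)%E.
  apply: le_ereal_inf_tmp => _ [U UB <-].
  apply: (@le_trans _ _ (\sum_(k <oo) box_volume ((+%R^~ w) @^-1` (U k)))%E).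
    by apply: ereal_inf_lbound => /=; exists (fun k => (+%R^~ w) @^-1` (U k)) => // x /UB.
  apply: lee_nneseries => k; first by move=> _ _; exact: box_volume_ge0.
  by move=> _; exact: box_volume_shift.
apply/eqP; rewrite eq_le le/=.
apply: le_trans (le (- v) _).
rewrite -comp_preimage (_ : _ \o _ = id) ?preimage_id//.
by apply/funext => x /=; rewrite subrK.
Qed.

Local Notation T := (lebT R d).

(** Caratheodory's identity for the shifted set, tested on X, is that of A tested on X shifted
    back. *)
Lemma measurable_shift (v : 'cV[R]_d) : measurable_fun setT (+%R^~ v : T -> T).
Proof.
move=> _ A mA; rewrite setTI.
suff : (@lebesgue_outer_measure R d).-caratheodory ((+%R^~ v) @^-1` A) by [].
move=> X; have /= := (mA : (@lebesgue_outer_measure R d).-caratheodory A)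
  ((+%R^~ (- v)) @^-1` X).
rewrite -[LHS](lebesgue_outer_shift v) -[X in _ = (X + _)%E -> _](lebesgue_outer_shift v).
rewrite -[X in _ = (_ + X)%E -> _](lebesgue_outer_shift v).
have E B : +%R^~ v @^-1` (+%R^~ (- v) @^-1` B) = B.
  by apply/seteqP; split => x /=; rewrite addrK.
by rewrite !preimage_setI E preimage_setC.
Qed.

Lemma integral_shift (v : 'cV[R]_d) (f : T -> \bar R) :
  measurable_fun setT f -> (forall x, 0 <= f x)%E ->
  (\int[Leb R d]_x f ((x : 'cV[R]_d) + v)%R = \int[Leb R d]_x f x)%E.
Proof.
move=> mf f0.
have := @ge0_integral_pushforward _ _ _ _ _ _ (measurable_shift v) (Leb R d) setT f.
rewrite preimage_setT => <- //.
apply: eq_measure_integral; first exact: measurable_shift.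
by move=> mv A mA _; exact: (lebesgue_outer_shift v A).
Qed.

End translation.

(** * Integration of compactly supported functions *)

Section compact_support.
Context (R : realType) (d : nat).
Implicit Types (h : 'cV[R]_d -> R) (K : set 'cV[R]_d) (v x : 'cV[R]_d).

Lemma compact_Leb_measurable K : compact K -> measurable (K : set (lebT R d)).
Proof.
move=> cK; rewrite -[X in measurable X]setCK; apply/measurableC/Leb_open.
by rewrite openC; apply: compact_closed => //; exact: norm_hausdorff.
Qed.

Lemma continuous_compact_bound h K : continuous h -> compact K ->
  (forall x, ~ K x -> h x = 0) -> exists2 M, 0 <= M & forall x, `|h x| <= M.
Proof.
move=> ch cK h0.
have /compact_bounded[M [Mr MP]] : compact (h @` K).
  by apply: continuous_compact => //; exact: continuous_subspaceT.
exists (`|M| + 1); first by rewrite addr_ge0.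
move=> x; have [Kx|Kx] := pselect (K x); last by rewrite h0// normr0 addr_ge0.
apply: (MP (`|M| + 1)); first by rewrite (le_lt_trans (ler_norm _)) ?ltrDl.
by exists x.
Qed.

Lemma compact_support_integrable h K : continuous h -> compact K ->
    (forall x, ~ K x -> h x = 0) ->
  (Leb R d).-integrable setT (EFin \o (h : lebT R d -> R)).
Proof.
move=> ch cK h0.
have mK := compact_Leb_measurable cK.
have -> : EFin \o h = (EFin \o h) \_ K.
  apply/funext => x; rewrite /patch; case: ifPn => //= /negP xK.
  by rewrite h0// => /mem_set.
apply: (integrable_mkcond _ mK).1; apply: measurable_bounded_integrable => //.
- exact/Leb_bounded_set/compact_bounded.
- exact: Leb_continuous.
- have [M M0 hM] := continuous_compact_bound ch cK h0.
  exists M; split => [|y My x Kx]; first exact: num_real.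
  by rewrite /= (le_trans _ (ltW My)).
Qed.

Lemma derive_off_support h K v x : closed K ->
  (forall x, ~ K x -> h x = 0) -> ~ K x -> 'D_v h x = 0.
Proof.
move=> cK h0 Kx; rewrite (@near_eq_derive _ _ _ h (cst 0)) ?derive_cst//.
have : open (~` K) by rewrite openC.
rewrite openE => /(_ x Kx); apply: filterS => y; exact: h0.
Qed.

Lemma Leb_integral_shift h v : measurable_fun setT (h : lebT R d -> R) ->
  (\int[Leb R d]_x (h ((x : 'cV[R]_d) + v)%R)%:E = \int[Leb R d]_x (h x)%:E)%E.
Proof.
move=> mh; rewrite integralE [RHS]integralE.
pose H : lebT R d -> \bar R := EFin \o h.
have mH : measurable_fun setT H by exact/measurable_EFinP.
congr (_ - _)%E.
  rewrite -[RHS](integral_shift v (measurable_funepos mH) (funepos_ge0 H)).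
  by apply: eq_integral => x _; rewrite !funeposE.
have := integral_shift v (measurable_funeneg mH) (funeneg_ge0 H) => <-.
by apply: eq_integral => x _; rewrite !funenegE.
Qed.

Lemma derivable_line h v x (t : R) : derivable h (x + t *: v) v ->
  is_derive t 1 (fun s : R => h (x + s *: v)) ('D_v h (x + t *: v)).
Proof.
have E : (fun k : R => k^-1 *: (((fun s : R => h (x + s *: v)) \o shift t) (k *: 1) -
      h (x + t *: v))) =
    (fun k : R => k^-1 *: ((h \o shift (x + t *: v)) (k *: v) - h (x + t *: v))).
  apply/funext => k /=; congr (_ *: (h _ - _)).
  by rewrite /shift/= [k *: 1]mulr1 scalerDl addrCA.
move=> dh; split; first by rewrite /derivable E.
by rewrite /derive E.
Qed.

Lemma ler_diff_line h v (C : R) x (t : R) : 0 <= t ->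
    (forall y, derivable h y v) -> (forall y, `|'D_v h y| <= C) ->
  `|h (x + t *: v) - h x| <= C * t.
Proof.
move=> t0 dh hC.
have dg (s : R) : is_derive s 1 (fun s : R => h (x + s *: v)) ('D_v h (x + s *: v)).
  exact: derivable_line.
have [|c _] := @MVT_segment _ (fun s : R => h (x + s *: v))
  (fun s => 'D_v h (x + s *: v)) 0 t t0 (fun s _ => dg s).
  apply: derivable_within_continuous => s _; exact: ex_derive.
rewrite scale0r addr0 subr0 => ->; rewrite normrM (ger0_norm t0).
by rewrite ler_wpM2r.
Qed.

(* By translation invariance every difference quotient of h has integral 0. *)
Lemma integral_derive_eq0 h v K : continuous h -> compact K ->
    (forall x, ~ K x -> h x = 0) -> (forall x, derivable h x v) ->
    continuous (fun x => 'D_v h x) ->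
  \int[Leb R d]_x ('D_v h x) = 0.
Proof.
move=> ch cK h0 dh cDh.
have clK : closed K by apply: compact_closed => //; exact: norm_hausdorff.
have [C C0 DhC] := continuous_compact_bound cDh cK
  (fun x Kx => @derive_off_support h K v x clK h0 Kx).
have [M _ MK] : exists2 M, 0 <= M & forall x, K x -> `|x| <= M.
  have [M [Mr MP]] := compact_bounded cK.
  exists (`|M| + 1); first by rewrite addr_ge0.
  by apply: (MP (`|M| + 1)); rewrite (le_lt_trans (ler_norm _)) ?ltrDl.
pose t (n : nat) : R := n.+1%:R^-1.
have t0 n : 0 < t n by rewrite invr_gt0.
have t1 n : t n <= 1 by rewrite invf_le1// ler1n.
pose f (n : nat) (x : 'cV[R]_d) := (t n)^-1 * (h (x + t n *: v) - h x).
(* As t n <= 1, both h and its shift by t n v vanish off [B]. The mean value inequality along v then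
   makes the constant C on [B] a common majorant of all the difference quotients. *)
pose B : set 'cV[R]_d := [set x | `|x| <= M + `|v|].
have mB : measurable (B : set (lebT R d)).
  rewrite -[X in measurable X]setCK; apply/measurableC/Leb_open.
  rewrite (_ : ~` B = Num.norm @^-1` `]M + `|v|, +oo[).
    apply: open_comp; last exact: interval_open.
    by move=> x _; exact: norm_continuous.
  by apply/seteqP; split => x /=; rewrite in_itv/= andbT ltNge => /negP.
have cshift (w : 'cV[R]_d) : continuous (fun x => h (x + w)).
  move=> x; apply: (@continuous_comp _ _ _ (fun x => x + w) h); last exact: ch.
  exact: (continuousD (@cvg_id _ _) (cvg_cst _)).
have mf n : measurable_fun setT (f n : lebT R d -> R).
  apply: Leb_continuous => x.
  apply: (@continuousM _ _ (cst (t n)^-1) (fun x => h (x + t n *: v) - h x)).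
    exact: cst_continuous.
  by apply: (@continuousB _ _ _ (fun x => h (x + t n *: v)) h); [exact: cshift|exact: ch].
have ih := compact_support_integrable ch cK h0.
have mh := Leb_continuous (D := setT) ch.
pose g : lebT R d -> \bar R := (cst C%:E) \_ B.
have ig : (Leb R d).-integrable setT g.
  apply: (integrable_mkcond _ mB).1.
  rewrite (_ : cst C%:E = EFin \o cst C)//.
  apply: measurable_bounded_integrable => //.
  - apply: Leb_bounded_set; exists (M + `|v|); split; first exact: num_real.
    by move=> y My x; rewrite /B/= => /le_trans; apply; exact: ltW.
  - exists C; split => [|y Cy x _]; first exact: num_real.
    by rewrite /= ger0_norm// ltW.
have fg n x : (`|(f n x)%:E| <= g x)%E.
  rewrite /g/patch; case: ifPn => [_|/negP xB].
    rewrite lee_fin /f normrM ger0_norm ?invr_ge0 ?(ltW (t0 n))//.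
    by rewrite ler_pdivrMl// mulrC; apply: ler_diff_line => //; exact: ltW.
  have xM : M + `|v| < `|x| by rewrite ltNge; apply/negP => xM; exact/xB/mem_set.
  have xK : ~ K x.
    by move=> /MK; rewrite leNgt (le_lt_trans _ xM)// lerDl.
  have xvK : ~ K (x + t n *: v).
    move=> /MK; apply/negP; rewrite -ltNge.
    rewrite -(ltrD2r `|v|) (lt_le_trans xM)//.
    rewrite -[x in `|x| <= _](addrK (t n *: v)) (le_trans (ler_normB _ _))// lerD2l.
    by rewrite normrZ ger0_norm ?(ltW (t0 _))// ler_piMl.
  by rewrite /f !h0// subrr mulr0 abse0.
have lim x : (f n x)%:E @[n --> \oo] --> ('D_v h x)%:E.
  apply: cvg_EFin; first by apply: nearW.
  pose q (k : R) := k^-1 *: ((h \o shift x) (k *: v) - h x).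
  have /cvgr_dnbhsP/(_ t) : q k @[k --> 0^'] --> 'D_v h x by exact: dh.
  rewrite (_ : (fun n => q (t n)) = f ^~ x).
    apply; split; last exact: cvg_harmonic.
    by move=> n; rewrite gt_eqF.
  by apply/funext => n; rewrite /q /f /= [_ *: _]/(_ * _) [x + _]addrC.
pose Dh : lebT R d -> R := fun x => 'D_v h (x : 'cV[R]_d).
have [_ _] := @dominated_convergence _ (lebT R d) R (Leb R d) setT measurableT
  (fun n x => (f n x)%:E) (fun x => (Dh x)%:E) g
  (fun n => (measurable_EFinP _ _).2 (mf n))
  ((measurable_EFinP _ _).2 (Leb_continuous cDh))
  (aeW (Leb R d) (fun (x : lebT R d) _ => lim x)) ig
  (aeW (Leb R d) (fun (x : lebT R d) n _ => fg n x)).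
have int0 n : (\int[Leb R d]_x (f n x)%:E = 0)%E.
  have ishift : (Leb R d).-integrable setT
      (EFin \o (fun x : lebT R d => h ((x : 'cV[R]_d) + t n *: v))).
    apply/integrableP; split.
      by apply/measurable_EFinP; exact/Leb_continuous/cshift.
    have mnh : measurable_fun setT ((fun x => `|h x|) : lebT R d -> R).
      by apply: Leb_continuous => x; apply: continuous_comp;
        [exact: ch|exact: norm_continuous].
    have /integrableP[_ ifin] := ih.
    have {ifin} : (\int[Leb R d]_x (`|h x|)%:E < +oo)%E := ifin.
    by rewrite -(Leb_integral_shift (t n *: v) mnh).
  have -> : (fun x => (f n x)%:E) =
      (fun x => ((t n)^-1)%:E * ((h (x + t n *: v))%:E - (h x)%:E))%E.
    by apply/funext => x; rewrite /f EFinM EFinB.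
  rewrite integralZl//; last exact: integrableB.
  rewrite integralB//= Leb_integral_shift// subee ?mule0//.
  exact: integrable_fin_num.
rewrite (_ : [sequence _]_n = cst 0%E); last exact/funext.
move=> /cvg_lim; rewrite lim_cst// => /(_ (@ereal_hausdorff R)) E.
by rewrite /Rintegral -E.
Qed.

End compact_support.

(** * Square integrable functions *)

Section square_integrable.
Context (disp : measure_display) (T : measurableType disp) (R : realType).
Context (mu : {measure set T -> \bar R}) (D : set T).
Hypothesis mD : measurable D.
Implicit Types f g : T -> R.

Lemma L2_integrableM f g : L2 mu D f -> L2 mu D g ->
  mu.-integrable D (EFin \o (fun x => f x * g x)).
Proof.
move=> [mf f2] [mg g2]; apply: (le_integrable mD _ _ (integrableD mD f2 g2)).
  by apply/measurable_EFinP; exact: measurable_funM.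
move=> x Dx /=; rewrite lee_fin normrM [leRHS]ger0_norm ?addr_ge0 ?sqr_ge0//.
rewrite -(real_normK (num_real (f x))) -(real_normK (num_real (g x))).
have := sqr_ge0 (`|f x| - `|g x|); have := normr_ge0 (f x).
have := normr_ge0 (g x); move: `|f x| `|g x| => p q q0 p0 pq. nra.
Qed.

Lemma L2D f g : L2 mu D f -> L2 mu D g -> L2 mu D (fun x => f x + g x).
Proof.
move=> Lf Lg; have [mf f2] := Lf; have [mg g2] := Lg.
split; first exact: measurable_funD.
have -> : (fun x => ((f x + g x) ^+ 2)%:E) =
    (((fun x => (f x ^+ 2)%:E) \+ (fun x => (2 * (f x * g x))%:E)) \+
     (fun x => (g x ^+ 2)%:E))%E.
  by apply/funext => x /=; rewrite -!EFinD; congr _%:E; ring.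
apply: (integrableD mD) g2; apply: (integrableD mD) f2 _.
exact: (integrableZl mD 2 (L2_integrableM Lf Lg)).
Qed.

Lemma L2Z (a : R) f : L2 mu D f -> L2 mu D (fun x => a * f x).
Proof.
move=> [mf f2]; split; first exact: measurable_funM.
have := integrableZl mD (a ^+ 2) f2.
apply: eq_integrable => // x _ /=; by rewrite exprMn EFinM.
Qed.

Lemma L2_sum (I : Type) (s : seq I) (f : I -> T -> R) :
  (forall i, L2 mu D (f i)) -> L2 mu D (fun x => \sum_(i <- s) f i x).
Proof.
move=> Lf; elim: s => [|i s IH].
  under eq_fun do rewrite big_nil.
  split; first exact: measurable_cst.
  by under eq_fun do rewrite expr0n/=; exact: integrable0.
under eq_fun do rewrite big_cons.
exact: L2D.
Qed.

(** Integrability has to come with the inequality: an infinite integral becomes 0 as a real number,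
    so the inequality alone would not control [f]. *)
Lemma ae_bound_integral f g (C : R) : 0 <= C ->
    measurable_fun D f -> (forall x, 0 <= f x) ->
    mu.-integrable D (EFin \o g) -> (forall x, 0 <= g x) ->
    {ae mu, forall x, D x -> f x <= C * g x} ->
  mu.-integrable D (EFin \o f) /\
  \int[mu]_(x in D) f x <= C * \int[mu]_(x in D) g x.
Proof.
move=> C0 mf f0 ig g0 fg.
have iCg := integrableZl mD C ig.
have /integrableP[mCg Cgfin] := iCg.
have le : (\int[mu]_(x in D) (f x)%:E <= \int[mu]_(x in D) (C%:E * (g x)%:E))%E.
  apply: ae_ge0_le_integral => //.
  - by move=> x _; rewrite lee_fin.
  - exact/measurable_EFinP.
  - by move=> x _; rewrite -EFinM lee_fin mulr_ge0.
have iF : mu.-integrable D (EFin \o f).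
  apply/integrableP; split; first exact/measurable_EFinP.
  under eq_integral => x _ do rewrite /= ger0_norm//.
  apply: (le_lt_trans le); apply: le_lt_trans Cgfin.
  by under [leRHS]eq_integral => x _ do
    rewrite /= ger0_norm ?mulr_ge0// EFinM.
split => //; rewrite -RintegralZl//.
apply: fine_le => //.
- exact: integrable_fin_num.
- by apply: integrable_fin_num => //; rewrite (_ : _ \o _ = fun x => C%:E * (g x)%:E)%E.
Qed.

Lemma L2_Linfty f c : Linfty mu D c -> L2 mu D f -> L2 mu D (fun x => c x * f x).
Proof.
move=> [mc [M cM]] [mf f2]; split; first exact: measurable_funM.
apply: (@ae_bound_integral (fun x => (c x * f x) ^+ 2) (fun x => f x ^+ 2)
  (M ^+ 2) (sqr_ge0 M) _ _ f2 _ _).1.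
- by apply: measurable_funX; exact: measurable_funM.
- by move=> x; exact: sqr_ge0.
- by move=> x; exact: sqr_ge0.
apply: filterS cM => x + Dx => /(_ Dx) cM.
rewrite exprMn ler_wpM2r ?sqr_ge0//.
by rewrite -(real_normK (num_real (c x))) lerXn2r// nnegrE// (le_trans _ cM).
Qed.

End square_integrable.

(* For a = (p, p), b = (p, q), c = (q, q), the hypothesis is 0 <= (p + t q, p + t q). *)
Lemma discriminant_le (R : realFieldType) (a b c : R) : 0 <= c ->
  (forall t, 0 <= a + 2 * t * b + t ^+ 2 * c) -> b ^+ 2 <= a * c.
Proof.
rewrite le_eqVlt => /predU1P[<-|c0] H.
  have [->|b0] := eqVneq b 0; first by rewrite expr0n mulr0.
  (* For c = 0 the expression is affine in t and this t makes it -1; for c > 0 the minimizer -b / c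
     is used below. *)
  have := H (- (a + 1) / (2 * b)); rewrite mulr0 addr0.
  rewrite (_ : _ * _ * b = - (a + 1)); last by field.
  by rewrite opprD addrA subrr add0r oppr_ge0 ler10.
have := H (- b / c).
rewrite (_ : _ + _ = (a * c - b ^+ 2) / c); last by field; rewrite gt_eqF.
by rewrite pmulr_lge0 ?invr_gt0// subr_ge0.
Qed.

(** * The inner product on L^2(Omega)^d x L^2(Omega) *)

Section pairs.
Context (R : realType) (d : nat) (Omega : set 'cV[R]_d).
Hypothesis mO : measurable (Omega : set (lebT R d)).

(** [R^o] is [R] as a module over itself, so that pairs of functions form an [R]-module and errors
    and residuals can be handled by its algebra. *)
Local Notation X := (('cV[R]_d -> 'cV[R]_d) * ('cV[R]_d -> R^o))%type.
Implicit Types p q r : X.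

(* H^1 and H(div) are both viewed inside L^2(Omega)^d x L^2(Omega), as
   (grad v, v) and (tau, div tau). *)
Definition ip2 p q : R := ipv Omega p.1 q.1 + ips Omega p.2 q.2.

Definition inL2 p : Prop := L2v Omega p.1 /\ L2s Omega p.2.

Lemma inL2D p q : inL2 p -> inL2 q -> inL2 (p + q).
Proof.
move=> [p1 p2] [q1 q2]; split; last exact: (L2D mO).
move=> i; rewrite (_ : (fun x => _) = (fun x => p.1 x i 0 + q.1 x i 0)).
  exact: (L2D mO (p1 i) (q1 i)).
by apply/funext => x; rewrite mxE.
Qed.

Lemma inL2Z (a : R) p : inL2 p -> inL2 (a *: p).
Proof.
move=> [p1 p2]; split; last exact: (L2Z mO).
move=> i; rewrite (_ : (fun x => _) = (fun x => a * p.1 x i 0)).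
  exact: (L2Z mO a (p1 i)).
by apply/funext => x; rewrite mxE.
Qed.

Lemma inL2B p q : inL2 p -> inL2 q -> inL2 (p - q).
Proof.
by move=> Lp /(inL2Z (-1)) Lq; have := inL2D Lp Lq; rewrite (scaleN1r q).
Qed.

Lemma dotv_integrable (F G : 'cV[R]_d -> 'cV[R]_d) : L2v Omega F -> L2v Omega G ->
  (Leb R d).-integrable Omega (EFin \o (fun x : lebT R d => dotv (F x) (G x))).
Proof.
move=> LF LG; rewrite (_ : _ \o _ = fun x => (\sum_(i < d) (F x i 0 * G x i 0)%:E)%E).
  by apply: integrable_sum => // i _; exact: (L2_integrableM mO (LF i) (LG i)).
by apply/funext => x /=; rewrite sumEFin.
Qed.

Lemma ip2_integrable p q : inL2 p -> inL2 q ->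
  (Leb R d).-integrable Omega
    (EFin \o (fun x : lebT R d => dotv (p.1 x) (q.1 x) + p.2 x * q.2 x)).
Proof.
move=> [p1 p2] [q1 q2].
exact: (integrableD mO (dotv_integrable p1 q1) (L2_integrableM mO p2 q2)).
Qed.

Lemma ip2E p q : inL2 p -> inL2 q ->
  ip2 p q = \int[Leb R d]_(x in Omega) (dotv (p.1 x) (q.1 x) + p.2 x * q.2 x).
Proof.
move=> [p1 p2] [q1 q2]; rewrite RintegralD//; first exact: dotv_integrable.
exact: (L2_integrableM mO).
Qed.

Lemma ip2C p q : ip2 p q = ip2 q p.
Proof.
congr (_ + _); apply: eq_Rintegral => x _; first exact: dotvC.
exact: mulrC.
Qed.

Lemma ip2Dl p q r : inL2 p -> inL2 q -> inL2 r -> ip2 (p + q) r = ip2 p r + ip2 q r.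
Proof.
move=> Lp Lq Lr; rewrite (ip2E (inL2D Lp Lq) Lr) (ip2E Lp Lr) (ip2E Lq Lr).
rewrite -(RintegralD mO (ip2_integrable Lp Lr) (ip2_integrable Lq Lr)).
by apply: eq_Rintegral => x _ /=; rewrite dotvDl mulrDl addrACA.
Qed.

Lemma ip2Zl (a : R) p r : inL2 p -> inL2 r -> ip2 (a *: p) r = a * ip2 p r.
Proof.
move=> Lp Lr; rewrite (ip2E (inL2Z a Lp) Lr) (ip2E Lp Lr).
rewrite -(RintegralZl a mO (ip2_integrable Lp Lr)).
by apply: eq_Rintegral => x _ /=; rewrite dotvZl -mulrA -mulrDr.
Qed.

Lemma ip2Dr p q r : inL2 p -> inL2 q -> inL2 r -> ip2 r (p + q) = ip2 r p + ip2 r q.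
Proof. by move=> Lp Lq Lr; rewrite ip2C (ip2Dl Lp Lq Lr) (ip2C p) (ip2C q). Qed.

Lemma ip2Zr (a : R) p r : inL2 p -> inL2 r -> ip2 r (a *: p) = a * ip2 r p.
Proof. by move=> Lp Lr; rewrite ip2C (ip2Zl a Lp Lr) ip2C. Qed.

Lemma ip2Nl p r : inL2 p -> inL2 r -> ip2 (- p) r = - ip2 p r.
Proof. by move=> Lp Lr; have := ip2Zl (-1) Lp Lr; rewrite (scaleN1r p) mulN1r. Qed.

Lemma ip2_ge0 p : 0 <= ip2 p p.
Proof.
by apply: addr_ge0; apply: Rintegral_ge0 => x _; rewrite ?dotv_ge0// -expr2 sqr_ge0.
Qed.

Lemma ip2_sqrD p q (t : R) : inL2 p -> inL2 q ->
  ip2 (p + t *: q) (p + t *: q) = ip2 p p + 2 * t * ip2 p q + t ^+ 2 * ip2 q q.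
Proof.
move=> Lp Lq; have Ltq := inL2Z t Lq; have Lpt := inL2D Lp Ltq.
rewrite (ip2Dl Lp Ltq Lpt) (ip2Dr Lp Ltq Lp) (ip2Dr Lp Ltq Ltq).
rewrite (ip2Zl t Lq Lp) (ip2Zl t Lq Ltq) (ip2Zr t Lq Lp) (ip2Zr t Lq Lq) (ip2C q p).
ring.
Qed.

Lemma ip2_CS p q : inL2 p -> inL2 q -> ip2 p q ^+ 2 <= ip2 p p * ip2 q q.
Proof.
move=> Lp Lq; apply: discriminant_le; first exact: ip2_ge0.
by move=> t; rewrite -(ip2_sqrD t Lp Lq) ip2_ge0.
Qed.

Lemma ip2_CS_sqrt p q : inL2 p -> inL2 q ->
  `|ip2 p q| <= Num.sqrt (ip2 p p) * Num.sqrt (ip2 q q).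
Proof.
move=> Lp Lq; rewrite -sqrtrM ?ip2_ge0// -sqrtr_sqr ler_wsqrtr//.
exact: ip2_CS.
Qed.

Lemma ip2_sqrD1 p q : inL2 p -> inL2 q ->
  ip2 (p + q) (p + q) = ip2 p p + 2 * ip2 p q + ip2 q q.
Proof.
move=> Lp Lq; have := ip2_sqrD 1 Lp Lq.
by rewrite (scale1r q) mulr1 expr1n mul1r.
Qed.

Lemma ip2_sqrD_le p q : inL2 p -> inL2 q ->
  ip2 (p + q) (p + q) <= 2 * ip2 p p + 2 * ip2 q q.
Proof.
move=> Lp Lq; have := ip2_ge0 (p + (-1) *: q).
rewrite (ip2_sqrD _ Lp Lq) (ip2_sqrD1 Lp Lq); lra.
Qed.

Lemma ip2_triangle p q : inL2 p -> inL2 q ->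
  Num.sqrt (ip2 (p + q) (p + q)) <= Num.sqrt (ip2 p p) + Num.sqrt (ip2 q q).
Proof.
move=> Lp Lq; rewrite -(ler_pXn2r (n := 2))// ?nnegrE ?addr_ge0 ?sqrtr_ge0//.
rewrite sqrrD !sqr_sqrtr ?ip2_ge0// (ip2_sqrD1 Lp Lq).
have := le_trans (ler_norm _) (ip2_CS_sqrt Lp Lq).
rewrite -mulr_natl; lra.
Qed.

End pairs.

Lemma dotv_CS (R : realType) (d : nat) (x y : 'cV[R]_d) :
  dotv x y ^+ 2 <= dotv x x * dotv y y.
Proof.
apply: discriminant_le; first exact: dotv_ge0.
move=> t; have := dotv_ge0 (x + t *: y).
by rewrite dotvDl !dotvDr !dotvZl !dotvZr (dotvC y x); congr (0 <= _); ring.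
Qed.

(** * The first-order operator of the problem *)

Section operator.
Context (R : realType) (d : nat) (Omega : set 'cV[R]_d).
Hypothesis mO : measurable (Omega : set (lebT R d)).
Variables (A : 'cV[R]_d -> 'M[R]_d) (b : 'cV[R]_d -> 'cV[R]_d) (c : 'cV[R]_d -> R).
Hypothesis hA : forall i j : 'I_d, Linftys Omega (fun x => A x i j).
Hypothesis hb : forall i : 'I_d, Linftys Omega (fun x => b x i 0).
Hypothesis hc : Linftys Omega c.

Local Notation X := (('cV[R]_d -> 'cV[R]_d) * ('cV[R]_d -> R^o))%type.
Implicit Types p q : X.

(** Chosen so that a(v, w) is, by definition, [ip2] of the image of (grad v, v) with (grad w, w). *)
Definition first_order_op p : X :=
  (fun x => A x *m p.1 x, fun x => dotv (b x) (p.1 x) + c x * p.2 x).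

Local Notation L := first_order_op.

Lemma first_order_opD p q : L (p + q) = L p + L q.
Proof.
congr pair; apply/funext => x /=; first by rewrite mulmxDr.
rewrite /= dotvDr mulrDr; exact: addrACA.
Qed.

Lemma first_order_opZ (a : R) p : L (a *: p) = a *: L p.
Proof.
congr pair; apply/funext => x /=; first by rewrite -scalemxAr.
by rewrite dotvZr mulrCA -mulrDr.
Qed.

Lemma first_order_op_L2 p : inL2 Omega p -> inL2 Omega (L p).
Proof.
move=> [p1 p2]; split => [i|].
  rewrite (_ : (fun x => _) = (fun x => \sum_j A x i j * p.1 x j 0)).
    by apply: (L2_sum mO) => j; exact: (L2_Linfty mO (hA i j) (p1 j)).
  by apply/funext => x; rewrite mxE.
apply: (L2D mO _ (L2_Linfty mO hc p2)).
by apply: (L2_sum mO) => i; exact: (L2_Linfty mO (hb i) (p1 i)).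
Qed.

(** Cauchy-Schwarz is applied at almost every point to each row of A and to b. [KA] and [Kb] are
    sums of squared essential bounds of the entries; the factors 2 come from (x + y)^2 <= 2 x^2 + 2
    y^2 in the second component. *)
Lemma first_order_op_bounded : exists2 K : R, 0 <= K & forall p, inL2 Omega p ->
  ip2 Omega (L p) (L p) <= K * ip2 Omega p p.
Proof.
have /choice[MA MAP] : forall ij : 'I_d * 'I_d, exists M : R,
    {ae Leb R d, forall x, Omega x -> `|A x ij.1 ij.2| <= M}.
  by move=> [i j]; have [_] := hA i j.
have /choice[Mb MbP] : forall i : 'I_d, exists M : R,
    {ae Leb R d, forall x, Omega x -> `|b x i 0| <= M}.
  by move=> i; have [_] := hb i.
have [_ [Mc McP]] := hc.
pose KA := \sum_i \sum_j MA (i, j) ^+ 2.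
pose Kb := \sum_i Mb i ^+ 2.
have KA0 : 0 <= KA by do 2!apply: sumr_ge0 => ? _; exact: sqr_ge0.
have Kb0 : 0 <= Kb by apply: sumr_ge0 => ? _; exact: sqr_ge0.
have Mc0 := sqr_ge0 Mc.
exists (KA + 2 * Kb + 2 * Mc ^+ 2) => [|p Lp]; first lra.
have sqM (a M : R) : `|a| <= M -> a ^+ 2 <= M ^+ 2.
  move=> aM; rewrite -(real_normK (num_real a)) lerXn2r// nnegrE//.
  exact: le_trans aM.
have LLp := first_order_op_L2 Lp.
rewrite !ip2E//.
apply: (ae_bound_integral mO _ _ _ (ip2_integrable mO Lp Lp) _ _).2.
- lra.
- by apply/measurable_EFinP; have /integrableP[] := ip2_integrable mO LLp LLp.
- by move=> x; rewrite addr_ge0 ?dotv_ge0// -expr2 sqr_ge0.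
- by move=> x; rewrite addr_ge0 ?dotv_ge0// -expr2 sqr_ge0.
have AB := filter_forall (ae_filter_ringOfSetsType (Leb R d)) MbP.
have AA := filter_forall (ae_filter_ringOfSetsType (Leb R d)) MAP.
apply: (filterS3 _ _ McP AA AB) => x Mcx MAx Mbx Ox /=.
set xi := p.1 x; set s := p.2 x.
have [xi0 s0] : 0 <= dotv xi xi /\ 0 <= s ^+ 2 by rewrite dotv_ge0 sqr_ge0.
have hAx : dotv (A x *m xi) (A x *m xi) <= KA * dotv xi xi.
  rewrite /KA mulr_suml; apply: ler_sum => i _.
  have -> : (A x *m xi) i 0 = dotv (\col_j A x i j) xi.
    by rewrite mxE; apply: eq_bigr => j _; rewrite mxE.
  rewrite -expr2 (le_trans (dotv_CS _ _))// ler_wpM2r//.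
  by apply: ler_sum => j _; rewrite mxE -expr2; apply: sqM; exact: (MAx (i, j) Ox).
have hbx : dotv (b x) xi ^+ 2 <= Kb * dotv xi xi.
  rewrite (le_trans (dotv_CS _ _))// ler_wpM2r//.
  by apply: ler_sum => i _; rewrite -expr2; apply: sqM; exact: Mbx.
have hcx : (c x * s) ^+ 2 <= Mc ^+ 2 * s ^+ 2.
  by rewrite exprMn ler_wpM2r//; apply: sqM; exact: Mcx.
have := sqr_ge0 (dotv (b x) xi - c x * s).
have := mulr_ge0 KA0 s0; have := mulr_ge0 Kb0 s0; have := mulr_ge0 Mc0 xi0.
rewrite -expr2; nra.
Qed.

End operator.

(** * The flux residual *)

Lemma measurable_det (disp : measure_display) (T : measurableType disp) (R : realType)
    (D : set T) (n : nat) (M : T -> 'M[R]_n) :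
  (forall i j, measurable_fun D (fun x => M x i j)) ->
  measurable_fun D (fun x => \det (M x)).
Proof.
move=> mM; apply: measurable_sum => s; apply: measurable_funM => //.
by apply: measurable_prod => i _.
Qed.

Section energy.
Context (R : realType) (d : nat).

(** As z is the root of M applied to r, z . z = r . M r, and ellipticity at r gives both bounds. The
    last formula is z . M^{-1} z by Cramer's rule: it no longer contains the chosen root, and its
    measurability can be read off the entries of M and z. *)
Lemma mxsqrt_energy (M : 'M[R]_d) (a0 a1 : R) : 0 < a0 -> M^T = M ->
    (forall xi : 'cV[R]_d, a0 * enorm xi ^+ 2 <= dotv xi (M *m xi) <= a1 * enorm xi ^+ 2) ->
  forall t g f : 'cV[R]_d,
    let r := invmx (mxsqrt M) *m t + mxsqrt M *m g + invmx (mxsqrt M) *m f in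
    let z := t + f + M *m g in
    [/\ a0 * dotv r r <= dotv z z, dotv z z <= a1 * dotv r r
      & dotv r r = powR (\det M) (-1) * dotv z (\adj M *m z)].
Proof.
move=> a0_gt0 Msym Mell t g f.
have Mpos (xi : 'cV[R]_d) : 0 <= dotv xi (M *m xi).
  have /andP[+ _] := Mell xi; apply: le_trans.
  by rewrite mulr_ge0 ?sqr_ge0// ltW.
(* [mxsqrt] is a choice with default 0; the existence of a root makes it a genuine one. *)
have [Ssym _ SS] : [/\ (mxsqrt M)^T = mxsqrt M,
    forall xi : 'cV[R]_d, 0 <= dotv xi (mxsqrt M *m xi)
    & mxsqrt M *m mxsqrt M = M].
  exact: (xgetPex 0 (psd_sqrt Msym Mpos)).
set S := mxsqrt M in Ssym SS *.
have detS : \det S != 0.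
  apply/negP => /det0P[v v0 vS].
  have Mv : M *m v^T = 0.
    by rewrite -SS -mulmxA -[S *m v^T]trmxK trmx_mul trmxK Ssym vS trmx0 mulmx0.
  have /andP[] := Mell v^T; rewrite Mv dotvE mulmx0 mxE enorm_sqr.
  rewrite pmulr_rle0// => vv _; apply/negP: v0; rewrite negbK.
  rewrite -(inj_eq trmx_inj) trmx0; apply/eqP/dotv_eq0/eqP.
  by rewrite eq_le vv dotv_ge0.
have Sunit : S \in unitmx by rewrite unitmxE unitfE.
move=> r z.
have rE : r = invmx S *m z.
  by rewrite /r /z -SS !mulmxDr -mulmxA mulKmx// addrAC.
have Sr : S *m r = z by rewrite rE mulKVmx.
have zz : dotv z z = dotv r (M *m r).
  by rewrite -Sr -SS -mulmxA [RHS]dotv_sym.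
have /andP[] := Mell r; rewrite enorm_sqr -zz => ? ?; split=> //.
have adjz : \adj M *m z = \det M *: (invmx S *m r).
  have {1}-> : z = M *m (invmx S *m r) by rewrite -SS -mulmxA mulKVmx.
  by rewrite mulmxA mul_adj_mx mul_scalar_mx.
have detM : 0 < \det M by rewrite -SS det_mulmx -expr2 exprn_even_gt0.
rewrite adjz dotvZr mulrA powR_inv1 ?ltW// mulVf ?gt_eqF// mul1r.
by rewrite dotv_sym ?trmx_inv ?Ssym// -rE.
Qed.

Variables (Omega : set 'cV[R]_d) (A : 'cV[R]_d -> 'M[R]_d) (a0 a1 : R).
Hypothesis mO : measurable (Omega : set (lebT R d)).
Hypothesis a0_gt0 : 0 < a0.
Hypothesis hA : forall i j : 'I_d, Linftys Omega (fun x => A x i j).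
Hypothesis hell : elliptic Omega A a0 a1.

(* r is built from mxsqrt, a mere choice at each point; it is measurable because
   |r|^2 = det(A)^-1 z . adj(A) z almost everywhere and Leb is complete. *)
Lemma energy_equivalence (t g f : 'cV[R]_d -> 'cV[R]_d) :
    let r x := invmx (mxsqrt (A x)) *m t x + mxsqrt (A x) *m g x
             + invmx (mxsqrt (A x)) *m f x in
    let z x := t x + f x + A x *m g x in
    L2v Omega z ->
  a0 * ipv Omega r r <= ipv Omega z z <= Num.max 0 a1 * ipv Omega r r.
Proof.
move=> r z Lz; pose aeS := @filterS _ _ (ae_filter_ringOfSetsType (Leb R d)).
have mA i j : measurable_fun (Omega : set (lebT R d)) (fun x : lebT R d => A x i j).
  by case: (hA i j).
have mz i : measurable_fun (Omega : set (lebT R d)) (fun x : lebT R d => z x i 0).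
  by case: (Lz i).
have izz := dotv_integrable mO Lz Lz.
have hr : {ae Leb R d, forall x, Omega x ->
    [/\ a0 * dotv (r x) (r x) <= dotv (z x) (z x),
      dotv (z x) (z x) <= a1 * dotv (r x) (r x)
    & dotv (r x) (r x) = powR (\det (A x)) (-1) * dotv (z x) (\adj (A x) *m z x)]}.
  apply: (aeS _ _ _ hell) => x H Ox; have [As Ae] := H Ox.
  exact: mxsqrt_energy.
have mr : measurable_fun (Omega : set (lebT R d)) (fun x : lebT R d => dotv (r x) (r x)).
  apply/measurable_EFinP.
  apply: (@ae_measurable_fun _ _ _ (Leb R d) _ Omega
    (fun x : lebT R d => (powR (\det (A x)) (-1) * dotv (z x) (\adj (A x) *m z x))%:E)).
  - exact: measure_is_complete_caratheodory.
  - by apply: (aeS _ _ _ hr) => x H Ox; have [_ _ <-] := H Ox.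
  apply/measurable_EFinP; apply: measurable_funM.
    apply: (measurableT_comp (f := fun y : R => powR y (-1))).
      exact: measurable_powR.
    exact: measurable_det.
  apply: measurable_sum => i; apply: measurable_funM; first exact: mz.
  under eq_fun do rewrite mxE.
  apply: measurable_sum => j; apply: measurable_funM; last exact: mz.
  under eq_fun do rewrite mxE.
  apply: measurable_funM; first exact: measurable_cst.
  apply: measurable_det => k l.
  under eq_fun do rewrite !mxE.
  exact: mA.
have rr0 x : 0 <= dotv (r x) (r x) by exact: dotv_ge0.
have zz0 x : 0 <= dotv (z x) (z x) by exact: dotv_ge0.
have a0V : 0 <= a0^-1 by rewrite invr_ge0 ltW.
have [ir rz] : (Leb R d).-integrable Omega (EFin \o (fun x : lebT R d => dotv (r x) (r x)))
    /\ ipv Omega r r <= a0^-1 * ipv Omega z z.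
  apply: (ae_bound_integral mO a0V mr rr0 izz zz0).
  by apply: (aeS _ _ _ hr) => x H Ox; have [+ _ _] := H Ox; rewrite ler_pdivlMl.
rewrite -ler_pdivlMl// rz/=.
(* The factor has to be nonnegative while the sign of [a1] is left open in this section, hence the
   maximum with 0. *)
apply: (ae_bound_integral mO _ _ zz0 ir rr0 _).2.
- by rewrite le_max lexx.
- by apply/measurable_EFinP; have /integrableP[] := izz.
apply: (aeS _ _ _ hr) => x H Ox; have [_ + _] := H Ox; move/le_trans; apply.
by rewrite ler_wpM2r// le_max lexx orbT.
Qed.

End energy.

(** * Smooth functions and the trace *)

(** Squeezed between 0 and 2 int f_n + C int g_n. It is meant for the errors of linear combinations
    of approximating sequences of traces, with C = 2 t^2. *)
Lemma integral_dominated_cvg0 (disp : measure_display) (T : measurableType disp)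
    (R : realType) (mu : {measure set T -> \bar R}) (D : set T) (mD : measurable D)
    (f g h : nat -> T -> R) (C : R) : 0 <= C ->
    (forall n, measurable_fun D (f n)) -> (forall n, measurable_fun D (g n)) ->
    (forall n, measurable_fun D (h n)) ->
    (forall n x, 0 <= f n x) -> (forall n x, 0 <= g n x) ->
    (forall n x, 0 <= h n x <= 2 * f n x + C * g n x) ->
    (\int[mu]_(x in D) (f n x)%:E)%E @[n --> \oo] --> 0%E ->
    (\int[mu]_(x in D) (g n x)%:E)%E @[n --> \oo] --> 0%E ->
  (\int[mu]_(x in D) (h n x)%:E)%E @[n --> \oo] --> 0%E.
Proof.
move=> C0 mf mg mh f0 g0 hfg cf cg.
have c2 : (2%:E * \int[mu]_(x in D) (f n x)%:E + C%:E * \int[mu]_(x in D) (g n x)%:E)%E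
    @[n --> \oo] --> (2%:E * 0 + C%:E * 0)%E.
  by apply: cvgeD; [rewrite !mule0|exact: cvgeZl|exact: cvgeZl].
rewrite !mule0 adde0 in c2; apply: squeeze_cvge (cvg_cst _) c2.
apply: nearW => n; apply/andP; split.
  by apply: integral_ge0 => x _; rewrite lee_fin; have /andP[] := hfg n x.
rewrite -!ge0_integralZl_EFin//; first last.
- exact/measurable_EFinP.
- by move=> x _; rewrite lee_fin.
- exact/measurable_EFinP.
- by move=> x _; rewrite lee_fin.
rewrite -ge0_integralD//; first last.
- by apply: measurable_funeM; exact/measurable_EFinP.
- by move=> x _; rewrite -EFinM lee_fin mulr_ge0.
- by apply: measurable_funeM; exact/measurable_EFinP.
- by move=> x _; rewrite -EFinM lee_fin mulr_ge0.
apply: ge0_le_integral => //.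
- by move=> x _; rewrite lee_fin; have /andP[] := hfg n x.
- exact/measurable_EFinP.
- by apply: emeasurable_funD; apply: measurable_funeM; exact/measurable_EFinP.
- by move=> x _; rewrite -!EFinM -EFinD lee_fin; have /andP[] := hfg n x.
Qed.

Section smooth_functions.
Context (R : realType) (d : nat).
Implicit Types (phi psi : 'cV[R]_d -> R) (Omega : set 'cV[R]_d).

Lemma smooth_continuous phi : smooth phi -> continuous phi.
Proof. by move=> /(_ [::])[]. Qed.

Lemma smooth_derivable phi x i : smooth phi -> derivable phi x (basisv R i).
Proof. by move=> /(_ [::])[]. Qed.

Lemma smooth_gradient_continuous phi i : smooth phi ->
  continuous (fun x => gradient phi x i 0).
Proof.
move=> /(_ [:: i])[cphi _].
rewrite (_ : (fun x => _) = partials [:: i] phi)//.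
by apply/funext => x; rewrite /gradient mxE.
Qed.

Lemma partials_lincomb phi psi (t : R) s : smooth phi -> smooth psi ->
  partials s (fun x => phi x + t * psi x) = (fun x => partials s phi x + t * partials s psi x).
Proof.
move=> sp sq; elim: s => [//|i s IH] /=; rewrite IH; apply/funext => x.
have [[_ dp] [_ dq]] := (sp s, sq s).
rewrite -[LHS]/('D_(basisv R i) (partials s phi + t \*: partials s psi) x).
by rewrite deriveD ?deriveZ//; exact: derivableZ.
Qed.

Lemma smooth_lincomb phi psi (t : R) : smooth phi -> smooth psi ->
  smooth (fun x => phi x + t * psi x).
Proof.
move=> sp sq s; rewrite partials_lincomb//.
have [[cp dp] [cq dq]] := (sp s, sq s); split=> [x|x i].
  apply: (@continuousD _ _ _ (partials s phi) (fun x => t * partials s psi x)).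
    exact: cp.
  by apply: (@continuousM _ _ (cst t) (partials s psi)); [exact: cst_continuous|exact: cq].
rewrite -[X in derivable X _ _]/(partials s phi + t \*: partials s psi).
by apply: derivableD => //; exact: derivableZ.
Qed.

Lemma gradient_lincomb phi psi (t : R) x : smooth phi -> smooth psi ->
  gradient (fun x => phi x + t * psi x) x = gradient phi x + t *: gradient psi x.
Proof.
move=> sp sq; apply/matrixP => i j; rewrite !mxE.
by have /(congr1 (fun f : 'cV[R]_d -> R => f x)) := @partials_lincomb phi psi t [:: i] sp sq.
Qed.

Lemma gradient_off_support phi (K : set 'cV[R]_d) x : compact K ->
  (forall x, ~ K x -> phi x = 0) -> ~ K x -> gradient phi x = 0.
Proof.
move=> cK phi0 Kx; apply/matrixP => i j; rewrite !mxE.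
apply: (@derive_off_support _ _ phi K _ x _ phi0 Kx).
by apply: compact_closed => //; exact: norm_hausdorff.
Qed.

(** The product of phi and psi is smooth and supported in a compact subset of Omega, so the integral
    over Omega of its derivative is one over the whole space, which is zero; the product rule does
    the rest. *)
Lemma smooth_integration_by_parts Omega phi psi i : open Omega -> smooth phi ->
    test_function Omega psi ->
  ips Omega phi (fun x => gradient psi x i 0) = - ips Omega (fun x => gradient phi x i 0) psi.
Proof.
move=> oO sp [sq [K [cK KO psi0]]].
have mO := Leb_open oO.
have gpsi0 x : ~ K x -> gradient psi x i 0 = 0.
  by move=> Kx; rewrite (gradient_off_support cK psi0 Kx) mxE.
have contM (f g : 'cV[R]_d -> R) : continuous f -> continuous g ->
    continuous (fun x => f x * g x).
  by move=> cf cg x; apply: (@continuousM _ _ f g); [exact: cf|exact: cg].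
have c1 := contM _ _ (smooth_continuous sp) (@smooth_gradient_continuous _ i sq).
have c2 := contM _ _ (@smooth_gradient_continuous _ i sp) (smooth_continuous sq).
have z1 x : ~ K x -> phi x * gradient psi x i 0 = 0 by move=> /gpsi0 ->; rewrite mulr0.
have z2 x : ~ K x -> gradient phi x i 0 * psi x = 0 by move=> /psi0 ->; rewrite mulr0.
have i1 := integrableS measurableT mO (@subsetT _ _)
  (compact_support_integrable c1 cK z1).
have i2 := integrableS measurableT mO (@subsetT _ _)
  (compact_support_integrable c2 cK z2).
apply/eqP; rewrite -addr_eq0 -(RintegralD mO i1 i2); apply/eqP.
have DE x : 'D_(basisv R i) (phi * psi) x =
    phi x * gradient psi x i 0 + gradient phi x i 0 * psi x.
  rewrite deriveM ?mxE; [|exact: smooth_derivable..].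
  by rewrite [X in _ + X]mulrC.
rewrite Rintegral_mkcond.
rewrite -[RHS](@integral_derive_eq0 _ _ (phi * psi) (basisv R i) K) //; first last.
- rewrite (_ : (fun x => _) = (fun x => phi x * gradient psi x i 0 + gradient phi x i 0 * psi x)).
    by move=> x; apply: (@continuousD _ _ _ (fun x => phi x * gradient psi x i 0)
      (fun x => gradient phi x i 0 * psi x)); [exact: c1|exact: c2].
  exact/funext.
- by move=> x; apply: derivableM; exact: smooth_derivable.
- by move=> x /psi0 /= E; rewrite -[LHS]/(phi x * psi x) E mulr0.
- exact: (contM _ _ (smooth_continuous sp) (smooth_continuous sq)).
apply: eq_Rintegral => x _; rewrite DE /patch; case: ifPn => // /negP xO.
have Kx : ~ K x by move=> /KO /mem_set.
by rewrite z1// z2// addr0.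
Qed.

Lemma test_function_H1 Omega phi : open Omega -> test_function Omega phi ->
  exists2 v : H1 Omega, h1val v = phi & h1grad v = gradient phi.
Proof.
move=> oO tphi; have [sphi [K [cK KO phi0]]] := tphi.
have mO := Leb_open oO.
have L2c (f : 'cV[R]_d -> R) : continuous f -> (forall x, ~ K x -> f x = 0) -> L2s Omega f.
  move=> cf f0; split; first exact: Leb_continuous.
  apply: (integrableS measurableT mO) => //.
  apply: (@compact_support_integrable _ _ (fun x => f x ^+ 2) K) => //.
    by move=> x; apply: (@continuousM _ _ f f); exact: cf.
  by move=> x /f0 ->; rewrite expr0n.
have Lphi := L2c _ (smooth_continuous sphi) phi0.
have Lgrad : L2v Omega (gradient phi).
  move=> i; apply: L2c; first exact: smooth_gradient_continuous.
  by move=> x Kx; rewrite (gradient_off_support cK phi0 Kx) mxE.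
have wg : weak_gradient Omega phi (gradient phi).
  by move=> psi tpsi i; exact: smooth_integration_by_parts.
by exists (MkH1 Lphi Lgrad wg).
Qed.

(** The constant sequence [v] approximates itself, and it vanishes on the boundary because the open
    set Omega, which contains the support, does not meet it. *)
Lemma test_function_trace Omega (v : H1 Omega) : open Omega ->
    test_function Omega v -> h1grad v = gradient v -> is_trace v (fun=> 0).
Proof.
move=> oO [sv [K [cK KO v0]]] gv; split.
  split; first exact: measurable_cst.
  by under eq_fun do rewrite expr0n/=; exact: integrable0.
exists (fun=> v); split => //.
  under eq_fun do under eq_integral do
    rewrite gv !subrr expr0n/= enorm_sqr dotvE mulmx0 mxE addr0.
  by under eq_fun do rewrite integral0; exact: cvg_cst.
have vb x : bdry Omega x -> v x = 0.
  move=> [_ xO]; apply: v0 => Kx; apply: xO.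
  by move: oO; rewrite openE; apply; exact: KO.
under eq_fun do under eq_integral => x /set_mem xb do rewrite vb// subrr expr0n/=.
by under eq_fun do rewrite integral0; exact: cvg_cst.
Qed.

End smooth_functions.

(** * Linear combinations in H^1(Omega) and linearity of the trace *)

Section H1_space.
Context (R : realType) (d : nat) (Omega : set 'cV[R]_d).
Hypothesis oO : open Omega.
Implicit Types v w z : H1 Omega.

Local Notation X := (('cV[R]_d -> 'cV[R]_d) * ('cV[R]_d -> R^o))%type.

Let mO := Leb_open oO.

Definition h1pair v : X := (h1grad v, h1val v).

Lemma h1pair_L2 v : inL2 Omega (h1pair v).
Proof. by split; [exact: h1grad_L2|exact: h1val_L2]. Qed.

Lemma norm1E v : norm1 v = Num.sqrt (ip2 Omega (h1pair v) (h1pair v)).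
Proof. by rewrite /norm1 /sqnorm1 addrC. Qed.

Lemma ips_lincombl (f g h : 'cV[R]_d -> R) (t : R) :
    L2s Omega f -> L2s Omega g -> L2s Omega h ->
  ips Omega (fun x => f x + t * g x) h = ips Omega f h + t * ips Omega g h.
Proof.
move=> Lf Lg Lh; have ifh := L2_integrableM mO Lf Lh.
have igh := L2_integrableM mO Lg Lh.
rewrite -(RintegralZl t mO igh) -(RintegralD mO ifh (integrableZl mO t igh)).
by apply: eq_Rintegral => x _; rewrite mulrDl mulrA.
Qed.

(** An element of H^1 is a record with proofs, so a combination is given as some element with the
    right pair; the pair fixes both the function and the gradient that it carries. *)
Lemma H1_lincomb v w (t : R) : exists z, h1pair z = h1pair v + t *: h1pair w.
Proof.
have Lw := inL2Z mO t (h1pair_L2 w).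
have [Lg Lv] := inL2D mO (h1pair_L2 v) Lw.
have wg : weak_gradient Omega (h1pair v + t *: h1pair w).2 (h1pair v + t *: h1pair w).1.
  move=> phi tphi i; have [p pv pg] := test_function_H1 oO tphi.
  have Lphi : L2s Omega phi by rewrite -pv; exact: h1val_L2.
  have Lgphi : L2s Omega (fun x => gradient phi x i 0) by rewrite -pg; exact: h1grad_L2.
  rewrite (ips_lincombl t (h1val_L2 v) (h1val_L2 w) Lgphi).
  rewrite (h1_weak_gradient v tphi) (h1_weak_gradient w tphi) mulrN -opprD.
  rewrite -(ips_lincombl t (h1grad_L2 v i) (h1grad_L2 w i) Lphi).
  by congr (- ips _ _ _); apply/funext => x; rewrite !mxE.
by exists (MkH1 Lv Lg wg).
Qed.

Lemma measurable_smooth_error (phi : 'cV[R]_d -> R) v : smooth phi ->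
  measurable_fun (Omega : set (lebT R d)) (fun x : lebT R d =>
    (phi x - v x) ^+ 2 + enorm (gradient phi x - h1grad v x) ^+ 2).
Proof.
move=> sphi; apply: measurable_funD.
  apply: measurable_funX; apply: measurable_funB.
    exact/Leb_continuous/smooth_continuous.
  by case: (h1val_L2 v).
under eq_fun do rewrite enorm_sqr.
apply: measurable_sum => i.
suff mi : measurable_fun (Omega : set (lebT R d))
    (fun x : lebT R d => (gradient phi x - h1grad v x) i 0).
  exact: measurable_funM.
under eq_fun do rewrite [_ i 0]mxE [in X in _ + X]mxE.
apply: measurable_funB; first exact/Leb_continuous/smooth_gradient_continuous.
by case: (h1grad_L2 v i).
Qed.

(** The approximating sequences are combined in the same way, and their squared errors are
    controlled by (a + t b)^2 <= 2 a^2 + 2 t^2 b^2, inside Omega and on its boundary. *)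
Lemma is_trace_lincomb v w z (t : R) g k :
    h1pair z = h1pair v + t *: h1pair w -> is_trace v g -> is_trace w k ->
  is_trace z (fun x => g x + t * k x).
Proof.
move=> [zg zv] [Lg [phi [sphi phiv phig]]] [Lk [psi [spsi psiw psik]]].
have mbd := @Surf_bdry R d Omega.
have sq2 (a b : R) : (a + t * b) ^+ 2 <= 2 * a ^+ 2 + 2 * t ^+ 2 * b ^+ 2.
  have := sqr_ge0 (a - t * b); nra.
have t2 : 0 <= 2 * t ^+ 2 by rewrite mulr_ge0// sqr_ge0.
split; first exact: (L2D mbd Lg (L2Z mbd t Lk)).
exists (fun n x => phi n x + t * psi n x); split.
- by move=> n; exact: smooth_lincomb.
- apply: (integral_dominated_cvg0 mO t2 _ _ _ _ _ _ phiv psiw) => n.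
  + exact: measurable_smooth_error.
  + exact: measurable_smooth_error.
  + exact/measurable_smooth_error/smooth_lincomb.
  + by move=> x; rewrite addr_ge0 ?sqr_ge0.
  + by move=> x; rewrite addr_ge0 ?sqr_ge0.
  move=> x; rewrite addr_ge0 ?sqr_ge0//= !enorm_sqr gradient_lincomb// zg zv /=.
  set p := phi n x; set q := psi n x; set P := gradient (phi n) x; set Q := gradient (psi n) x.
  have E1 : p + t * q - (v x + t * w x) = (p - v x) + t * (q - w x) by ring.
  have E2 : P + t *: Q - (h1grad v x + t *: h1grad w x) =
      (P - h1grad v x) + t *: (Q - h1grad w x).
    by rewrite scalerBr opprD addrACA.
  rewrite -[leLHS]/((p + t * q - (v x + t * w x)) ^+ 2 +
    dotv (P + t *: Q - (h1grad v x + t *: h1grad w x))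
         (P + t *: Q - (h1grad v x + t *: h1grad w x))) E1 E2.
  have dv (F G : 'cV[R]_d) : dotv (F + t *: G) (F + t *: G) <=
      2 * dotv F F + 2 * t ^+ 2 * dotv G G.
    have := dotv_ge0 (F + (- t) *: G).
    rewrite !dotvDl !dotvDr !dotvZl !dotvZr (dotvC G F); nra.
  rewrite (le_trans (lerD (sq2 _ _) (dv _ _)))// le_eqVlt; apply/orP; left.
  apply/eqP; ring.
- apply: (integral_dominated_cvg0 mbd t2 _ _ _ _ _ _ phig psik) => n.
  + apply: measurable_funX; apply: measurable_funB; last by case: Lg.
    exact/Surf_continuous/smooth_continuous.
  + apply: measurable_funX; apply: measurable_funB; last by case: Lk.
    exact/Surf_continuous/smooth_continuous.
  + apply: measurable_funX; apply: measurable_funB.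
      exact/Surf_continuous/smooth_continuous/smooth_lincomb.
    apply: measurable_funD; first by case: Lg.
    by apply: measurable_funM => //; case: Lk.
  + by move=> x; exact: sqr_ge0.
  + by move=> x; exact: sqr_ge0.
  move=> x; rewrite sqr_ge0/= (_ : _ - _ = (phi n x - g x) + t * (psi n x - k x)) ?sq2//.
  ring.
Qed.

(** With t = -1 this puts u - w in H^1_D; with t = n it keeps w0 + n e there. *)
Lemma trace_eq_on_lincomb (Gamma : set 'cV[R]_d) v w z (t : R) p q :
    h1pair z = h1pair v + t *: h1pair w ->
    trace_eq_on Gamma v p -> trace_eq_on Gamma w q ->
  trace_eq_on Gamma z (fun x => p x + t * q x).
Proof.
move=> zE [g vg gp] [k wk kq].
exists (fun x => g x + t * k x); first exact: is_trace_lincomb zE vg wk.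
apply: (@filterS2 _ _ (ae_filter_ringOfSetsType (Surf R d)) _ _ _ _ gp kq).
by move=> x gpx kqx Gx; rewrite gpx// kqx.
Qed.

End H1_space.

(** * The inf-sup condition *)

Section inf_sup.
Context (R : realType) (d : nat) (Omega GammaD : set 'cV[R]_d).
Hypothesis oO : open Omega.
Variables (A : 'cV[R]_d -> 'M[R]_d) (b : 'cV[R]_d -> 'cV[R]_d) (c : 'cV[R]_d -> R).
Hypothesis hA : forall i j : 'I_d, Linftys Omega (fun x => A x i j).
Hypothesis hb : forall i : 'I_d, Linftys Omega (fun x => b x i 0).
Hypothesis hc : Linftys Omega c.
Variable beta : R.
Hypotheses (beta_gt0 : 0 < beta) (hbeta : inf_sup Omega GammaD A b c beta).
Implicit Types v w e : H1 Omega.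

Let mO := Leb_open oO.
Local Notation L := (first_order_op A b c).

Lemma bilinE v w : bilin A b c v w = ip2 Omega (L (h1pair v)) (h1pair w).
Proof. by []. Qed.

Lemma norm1_ge0 v : 0 <= norm1 v.
Proof. exact: sqrtr_ge0. Qed.

Lemma inf_sup_nonzero w (F : R) : 0 <= F -> H1D_nonzero GammaD w ->
    (forall v, H1D GammaD v -> bilin A b c w v <= F * norm1 v) ->
  beta * norm1 w <= F.
Proof.
move=> F0 wNZ bF.
have : beta <= F / norm1 w.
  rewrite -lee_fin hbeta.1; apply: (@le_trans _ _ (ereal_sup
      [set (bilin A b c w v / (norm1 w * norm1 v))%:E | v in H1D_nonzero GammaD])).
    by apply: ereal_inf_lbound; exists w.
  apply: ge_ereal_sup => _ [v [vD _] <-]; rewrite lee_fin invfM mulrCA mulrC.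
  rewrite ler_wpM2r ?invr_ge0 ?norm1_ge0//.
  (* Division by zero gives 0, so a [v] of norm zero contributes the value 0, which is at most F. *)
  have [->|v0] := eqVneq (norm1 v) 0; first by rewrite invr0 mulr0.
  by rewrite ler_pdivrMr ?bF// lt_neqAle eq_sym v0 norm1_ge0.
have [->|w0] := eqVneq (norm1 w) 0; first by rewrite mulr0.
by rewrite ler_pdivlMr// lt_neqAle eq_sym w0 norm1_ge0.
Qed.

(** Otherwise the infimum would be that of the empty set, +oo, and not the real number beta. *)
Lemma H1D_nonzero_nonempty : exists w : H1 Omega, H1D_nonzero GammaD w.
Proof.
apply: contrapT => /forallNP NZ; have := hbeta.1.
rewrite (_ : H1D_nonzero GammaD = set0) ?image_set0 ?ereal_inf0//.
by apply/seteqP; split => w // /NZ.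
Qed.

(* An e that vanishes almost everywhere is not covered by the infimum, but then
   w0 + n e is, for any admissible w0; divide by n. *)
Lemma inf_sup_stability e (F : R) : 0 <= F -> H1D GammaD e ->
    (forall v, H1D GammaD v -> bilin A b c e v <= F * norm1 v) ->
  beta * norm1 e <= F.
Proof.
move=> F0 eD bF.
have [e0|] := pselect {ae Leb R d, forall x, Omega x -> e x = 0}; last first.
  by move=> e0; exact: inf_sup_nonzero.
have [w0 [w0D w0NZ]] := H1D_nonzero_nonempty.
have Lw0 := h1pair_L2 w0; have Le := h1pair_L2 e.
have LLw0 := first_order_op_L2 mO hA hb hc Lw0.
have LLe := first_order_op_L2 mO hA hb hc Le.
pose K := Num.sqrt (ip2 Omega (L (h1pair w0)) (L (h1pair w0))).
have K0 : 0 <= K by exact: sqrtr_ge0.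
(* For w = w0 + n e, the term L w0 costs K by Cauchy-Schwarz, and |w|_1 >= n |e|_1 - |w0|_1 costs
   beta |w0|_1. Neither depends on n. As e = 0 almost everywhere, w equals w0 there and is
   admissible. *)
have bn n : n%:R * (beta * norm1 e) <= (K + beta * norm1 w0) + n%:R * F.
  have [w wE] := H1_lincomb oO w0 e n%:R.
  have wD : H1D GammaD w.
    have := trace_eq_on_lincomb oO wE w0D eD.
    by congr trace_eq_on; apply/funext => x; rewrite mulr0 addr0.
  have Lne := inL2Z mO n%:R Le.
  have LLne := inL2Z mO n%:R LLe.
  have wNZ : H1D_nonzero GammaD w.
    split => // w_eq0; apply: w0NZ.
    apply: (@filterS2 _ _ (ae_filter_ringOfSetsType (Leb R d)) _ _ _ _ e0 w_eq0).
    move=> x ex wx Ox; have := wx Ox.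
    have -> : h1val w = (h1pair w).2 by [].
    by rewrite wE -[LHS]/(w0 x + n%:R * e x) ex// mulr0 addr0.
  have bw : beta * norm1 w <= K + n%:R * F.
    apply: inf_sup_nonzero => //; first by rewrite addr_ge0// mulr_ge0.
    move=> v vD; rewrite bilinE wE first_order_opD first_order_opZ.
    rewrite (ip2Dl mO LLw0 LLne (h1pair_L2 v)) (ip2Zl mO n%:R LLe (h1pair_L2 v)).
    rewrite mulrDl lerD//.
      rewrite norm1E (le_trans (ler_norm _))//.
      exact: (ip2_CS_sqrt mO LLw0 (h1pair_L2 v)).
    by rewrite -mulrA ler_wpM2l// bF.
  have : norm1 w >= n%:R * norm1 e - norm1 w0.
    have Lw := h1pair_L2 w; have LNw0 := inL2Z mO (-1) Lw0.
    have := ip2_triangle mO Lw LNw0.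
    have -> : h1pair w + -1 *: h1pair w0 = n%:R *: h1pair e.
      by rewrite wE (scaleN1r (h1pair w0)) addrAC subrr add0r.
    rewrite (ip2Zl mO _ Le Lne) (ip2Zr mO _ Le Le) (ip2Zl mO _ Lw0 LNw0) (ip2Zr mO _ Lw0 Lw0).
    rewrite mulrA -expr2 sqrtrM ?sqr_ge0// sqrtr_sqr normr_nat mulrA mulrNN !mul1r.
    rewrite -!norm1E; lra.
  move=> nw; have := ler_wpM2l (ltW beta_gt0) nw; lra.
rewrite leNgt; apply/negP => Fe.
have Fe0 : 0 < beta * norm1 e - F by rewrite subr_gt0.
(* Every natural number above this quotient contradicts [bn]. *)
pose M := (K + beta * norm1 w0) / (beta * norm1 e - F).
have := bn (Num.truncn M).+1.
have := truncnS_gt M; rewrite /M ltr_pdivrMr//.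
lra.
Qed.

End inf_sup.

(** * Norm equivalence *)

Section error_identity.
Context (R : realType) (d : nat) (Omega : set 'cV[R]_d).
Hypothesis mO : measurable (Omega : set (lebT R d)).

Local Notation X := (('cV[R]_d -> 'cV[R]_d) * ('cV[R]_d -> R^o))%type.

Definition hdivpair (tau : Hdiv Omega) : X := (hdivval tau, hdivdiv tau).

Lemma hdivpair_L2 tau : inL2 Omega (hdivpair tau).
Proof. by split; [exact: hdivval_L2|exact: hdivdiv_L2]. Qed.

Lemma ip2NN (p : X) : inL2 Omega p -> ip2 Omega (- p) (- p) = ip2 Omega p p.
Proof.
move=> Lp; have := inL2Z mO (-1) Lp; rewrite (scaleN1r p) => LNp.
by rewrite (ip2Nl mO Lp LNp) ip2C (ip2Nl mO Lp Lp) opprK.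
Qed.

End error_identity.

(** To be read with D = (-f_2, f_1), t = (tau, div tau), Lu = L u and Lw = L w: the left side is Z,
    and D - Lu is (sigma, div sigma). *)
Lemma residualE (V : zmodType) (D t Lu Lw : V) :
  t - D + Lw = - ((D - Lu - t) + (Lu - Lw)).
Proof.
by rewrite [in RHS](addrAC D) [in RHS]addrA subrK !opprB addrC.
Qed.

Theorem theorem5p3 (R : realType) (d : nat) (hd : (2 <= d)%N)
  (Omega GammaD GammaN : set 'cV[R]_d)
  (hOmega : lipschitz_domain Omega) (hbounded : bounded_set Omega)
  (hGammaD : relatively_open_in_bdry Omega GammaD)
  (hGammaN : relatively_open_in_bdry Omega GammaN)
  (hdisjoint : GammaD `&` GammaN = set0)
  (hcover : bdry Omega = closure GammaD `|` closure GammaN)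
  (hGammaD_pos : (0 < Surf R d GammaD)%E)
  (A : 'cV[R]_d -> 'M[R]_d) (b : 'cV[R]_d -> 'cV[R]_d) (c : 'cV[R]_d -> R)
  (a0 a1 : R) (ha : 0 < a0 <= a1)
  (hA : forall i j : 'I_d, Linftys Omega (fun x => A x i j))
  (hell : elliptic Omega A a0 a1)
  (hb : forall i : 'I_d, Linftys Omega (fun x => b x i 0))
  (hc : Linftys Omega c)
  (f1 : 'cV[R]_d -> R) (hf1 : L2s Omega f1)
  (f2 : 'cV[R]_d -> 'cV[R]_d) (hf2 : L2v Omega f2)
  (psip : 'cV[R]_d -> R) (hpsip : L2 (Surf R d) GammaN psip)
  (phip : 'cV[R]_d -> R) (hphip : Hhalf_on Omega GammaD phip)
  (hSigma : exists tau0 : Hdiv Omega, normal_trace_eq GammaD GammaN tau0 psip)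
  (beta : R) (hbeta : 0 < beta) (hinfsup : inf_sup Omega GammaD A b c beta)
  (u : H1 Omega)
  (hu : primal_solution GammaD GammaN A b c f1 f2 psip phip u) :
  exists sigma : Hdiv Omega,
    (forall x, sigma x = - (A x *m h1grad u x) - f2 x) /\
    exists c1 C1 : R, [/\ 0 < c1, 0 < C1
      & forall (tau : Hdiv Omega) (w : H1 Omega),
          normal_trace_eq GammaD GammaN tau psip ->
          trace_eq_on GammaD w phip ->
          c1 * triple_norm_diff sigma tau u w <= etaLS A b c f1 f2 tau w
          /\ etaLS A b c f1 f2 tau w <= C1 * triple_norm_diff sigma tau u w].
Proof.
have oO : open Omega by case: hOmega.
have mO := Leb_open oO.
have /andP[a0_gt0 a01] := ha.
have a1_gt0 : 0 < a1 := lt_le_trans a0_gt0 a01.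
(* The data as a pair, with signs such that l(s) is its product with (grad s, s) minus the boundary
   term. *)
pose D : ('cV[R]_d -> 'cV[R]_d) * ('cV[R]_d -> R^o) := (fun x => - f2 x, f1).
have LD : inL2 Omega D.
  split=> [i|]; last exact: hf1.
  have := L2Z mO (-1) (hf2 i).
  by congr L2; apply/funext => x; rewrite mxE mulN1r.
pose L := first_order_op A b c.
have LL p : inL2 Omega p -> inL2 Omega (L p) := @first_order_op_L2 _ _ _ mO A b c hA hb hc p.
have [K K0 KL] := first_order_op_bounded mO hA hb hc.
have Lu := h1pair_L2 u; have LLu := LL _ Lu.
pose S := D - L (h1pair u).
have LS : inL2 Omega S by exact: inL2B.
(* Green's formula for [S], which is not yet known to be a field with its divergence. With test
   functions, whose trace is 0, it yields the weak divergence; compared with the same formula for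
   tau, it yields the orthogonality of the error. *)
have S_trace (s0 : H1 Omega) g : H1D GammaD s0 -> is_trace s0 g ->
    ip2 Omega S (h1pair s0) = ipb GammaN psip g.
  move=> s0D s0g; have Ls0 := h1pair_L2 s0.
  have [_ /(_ s0 s0D g s0g)] := hu.
  have Df2 : ipv Omega D.1 (h1grad s0) = - ipv Omega f2 (h1grad s0).
    rewrite -mulN1r -(RintegralZl (-1) mO (dotv_integrable mO hf2 (h1grad_L2 s0))).
    by apply: eq_Rintegral => x _; rewrite dotvNl mulN1r.
  rewrite bilinE /linform => uE.
  have LNu : inL2 Omega (- L (h1pair u)).
    by have := inL2Z mO (-1) LLu; rewrite (scaleN1r (L (h1pair u))).
  rewrite (ip2Dl mO LD LNu Ls0) (ip2Nl mO LLu Ls0) uE /ip2 Df2 /=; ring.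
have wdiv : weak_divergence Omega S.1 S.2.
  move=> phi tphi; have [p pv pg] := test_function_H1 oO tphi.
  have ptr : is_trace p (fun=> 0).
    by apply: test_function_trace => //; rewrite ?pv// pg.
  have pD : H1D GammaD p.
    by exists (fun=> 0) => //; apply: aeW => x.
  have := S_trace p _ pD ptr.
  rewrite (_ : ipb GammaN psip (fun=> 0) = 0); last first.
    rewrite /ipb (eq_Rintegral _ (g := cst 0)); last by move=> x _; rewrite mulr0.
    by rewrite /Rintegral integral0.
  by rewrite /ip2 /= pv pg => /eqP; rewrite addr_eq0 => /eqP.
pose sigma := MkHdiv LS.1 LS.2 wdiv.
exists sigma; split; first by move=> x; rewrite /= addrC.
(* With eta the estimator, |Z|^2 <= M1 eta^2 and eta^2 <= M0 |Z|^2. For the lower estimate, |E|^2 +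
   |e|_1^2 <= 2 |Z|^2 + (2 K + 1) |e|_1^2, and |e|_1^2 <= |Z|^2 / beta^2 gives the factor [Q]. For
   the upper one, |Z|^2 <= 2 |E|^2 + 2 K |e|_1^2 gives [P]. *)
pose M1 := 1 + a1; pose M0 := 1 + a0^-1.
have M0_gt0 : 0 < M0 by rewrite addr_gt0// invr_gt0.
have M1_gt0 : 0 < M1 by rewrite addr_gt0.
pose Q := (2 + (2 * K + 1) / beta ^+ 2) * M1.
have beta2 : 0 < beta ^+ 2 by rewrite exprn_gt0.
have Q_gt0 : 0 < Q.
  rewrite mulr_gt0// ltr_wpDr// divr_ge0 ?(ltW beta2)//.
  by rewrite addr_ge0// mulr_ge0.
pose P := M0 * (2 * (1 + K)).
have P_gt0 : 0 < P by rewrite mulr_gt0// mulr_gt0// ltr_wpDr.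
exists (Num.sqrt Q)^-1, (Num.sqrt P).
split; [by rewrite invr_gt0 sqrtr_gt0|by rewrite sqrtr_gt0|].
move=> tau w tau_tr w_tr.
have Lt := hdivpair_L2 tau; have Lw := h1pair_L2 w; have LLw := LL _ Lw.
pose E := S - hdivpair tau.
have LE : inL2 Omega E by exact: inL2B.
have [e eE] := H1_lincomb oO u w (-1).
have Le := h1pair_L2 e; have LLe := LL _ Le.
have eE' : h1pair e = h1pair u - h1pair w by rewrite eE (scaleN1r (h1pair w)).
have eD : H1D GammaD e.
  have := trace_eq_on_lincomb oO eE hu.1 w_tr.
  move=> [g ge g0]; exists g => //.
  apply: (@filterS _ _ (ae_filter_ringOfSetsType (Surf R d)) _ _ _ g0) => x H /H ->.
  by rewrite mulN1r subrr.
have LeE : L (h1pair e) = L (h1pair u) - L (h1pair w).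
  rewrite /L eE first_order_opD first_order_opZ.
  by rewrite (scaleN1r (first_order_op A b c (h1pair w))).
pose Z := hdivpair tau - D + L (h1pair w).
have ZE : Z = - (E + L (h1pair e)) by rewrite LeE; exact: residualE.
have LEL := inL2D mO LE LLe.
have LZ : inL2 Omega Z.
  by have := inL2Z mO (-1) LEL; rewrite (scaleN1r (E + L (h1pair e))) -ZE.
have E_orth (v : H1 Omega) : H1D GammaD v -> ip2 Omega E (h1pair v) = 0.
  move=> vD; have Lv := h1pair_L2 v; have [g vg _] := vD.
  have LNt := inL2Z mO (-1) Lt; rewrite (scaleN1r (hdivpair tau)) in LNt.
  rewrite (ip2Dl mO LS LNt Lv) (ip2Nl mO Lt Lv) (S_trace v g vD vg).
  by rewrite -(tau_tr v vD g vg) subrr.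
have LLe_orth (v : H1 Omega) : H1D GammaD v ->
    ip2 Omega (L (h1pair e)) (h1pair v) = - ip2 Omega Z (h1pair v).
  move=> vD; have Lv := h1pair_L2 v.
  by rewrite ZE (ip2Nl mO LEL Lv) (ip2Dl mO LE LLe Lv) (E_orth v vD) add0r opprK.
have e_bound : beta * norm1 e <= Num.sqrt (ip2 Omega Z Z).
  apply: (inf_sup_stability oO hA hb hc hbeta hinfsup (sqrtr_ge0 _) eD) => v vD.
  rewrite bilinE (LLe_orth v vD) norm1E (le_trans (ler_norm _))// normrN.
  exact: (ip2_CS_sqrt mO LZ (h1pair_L2 v)).
have ee_le : beta ^+ 2 * ip2 Omega (h1pair e) (h1pair e) <= ip2 Omega Z Z.
  rewrite -(sqr_sqrtr (ip2_ge0 Omega (h1pair e))) -norm1E -exprMn.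
  rewrite -(sqr_sqrtr (ip2_ge0 Omega Z)) lerXn2r// nnegrE ?sqrtr_ge0//.
  by rewrite mulr_ge0 ?norm1_ge0// ltW.
have EZ : E = - (Z + L (h1pair e)).
  by rewrite ZE (opprD E) -addrA (addNr (L (h1pair e))) addr0 opprK.
have LZL := inL2D mO LZ LLe.
have ZZ_le : ip2 Omega Z Z <=
    2 * ip2 Omega E E + 2 * ip2 Omega (L (h1pair e)) (L (h1pair e)).
  by rewrite [in leLHS]ZE (ip2NN mO LEL); exact: (ip2_sqrD_le mO LE LLe).
have EE_le : ip2 Omega E E <=
    2 * ip2 Omega Z Z + 2 * ip2 Omega (L (h1pair e)) (L (h1pair e)).
  by rewrite [in leLHS]EZ (ip2NN mO LZL); exact: (ip2_sqrD_le mO LZ LLe).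
have LL_le := KL _ Le.
have tripleE : triple_norm_diff sigma tau u w =
    Num.sqrt (ip2 Omega E E + ip2 Omega (h1pair e) (h1pair e)).
  rewrite /triple_norm_diff eE'; congr (Num.sqrt (_ + _)).
  by rewrite /sqnorm1 addrC.
rewrite tripleE.
have Z1E : Z.1 = (fun x => tau x + f2 x + A x *m h1grad w x).
  by apply/funext => x; rewrite -[LHS]/(tau x - - f2 x + A x *m h1grad w x) opprK.
have Z2E : Z.2 = (fun x => hdivdiv tau x + dotv (b x) (h1grad w x) + c x * w x - f1 x).
  apply/funext => x.
  rewrite -[LHS]/(hdivdiv tau x - f1 x + (dotv (b x) (h1grad w x) + c x * w x)).
  ring.
have := LZ.1; rewrite Z1E => Lz.
have := energy_equivalence mO a0_gt0 hA hell Lz; rewrite -Z1E.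
set r := (fun x => _ + _ + _); rewrite (max_r (ltW a1_gt0)) => /andP[rz zr].
have etaE : etaLS A b c f1 f2 tau w =
    Num.sqrt (ipv Omega r r + ips Omega Z.2 Z.2) by rewrite Z2E.
rewrite etaE.
have rr0 : 0 <= ipv Omega r r by apply: Rintegral_ge0 => x _; exact: dotv_ge0.
have qq0 : 0 <= ips Omega Z.2 Z.2.
  by apply: Rintegral_ge0 => x _; rewrite -expr2 sqr_ge0.
have zz0 : 0 <= ipv Omega Z.1 Z.1 by apply: Rintegral_ge0 => x _; exact: dotv_ge0.
have ZZ : ip2 Omega Z Z = ipv Omega Z.1 Z.1 + ips Omega Z.2 Z.2 by [].
have EE0 := ip2_ge0 Omega E; have ee0 := ip2_ge0 Omega (h1pair e).
(* Only real arithmetic between seven squared norms remains. *)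
move: (ip2 Omega Z Z) (ip2 Omega E E) (ip2 Omega (h1pair e) (h1pair e))
  (ip2 Omega (L (h1pair e)) (L (h1pair e))) (ipv Omega r r) (ips Omega Z.2 Z.2)
  (ipv Omega Z.1 Z.1) ee_le ZZ_le EE_le LL_le rz zr rr0 qq0 zz0 ZZ EE0 ee0.
move=> ZZ EE ee LLee rr qq zz ee_le ZZ_le EE_le LL_le rz zr rr0 qq0 zz0 ZZE EE0 ee0.
split.
  rewrite ler_pdivrMl ?sqrtr_gt0// -sqrtrM ?(ltW Q_gt0)// ler_wsqrtr//.
  have ZZM : ZZ <= M1 * (rr + qq).
    have := mulr_ge0 (ltW a1_gt0) qq0; rewrite /M1 ZZE; nra.
  have eeZ : ee <= ZZ / beta ^+ 2 by rewrite ler_pdivlMr// mulrC.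
  apply: (@le_trans _ _ ((2 + (2 * K + 1) / beta ^+ 2) * ZZ)).
    have K1 : 0 <= 2 * K + 1 by rewrite addr_ge0// mulr_ge0.
    have -> : (2 + (2 * K + 1) / beta ^+ 2) * ZZ =
        2 * ZZ + (2 * K + 1) * (ZZ / beta ^+ 2) by ring.
    have := ler_wpM2l K1 eeZ; lra.
  by rewrite -mulrA ler_wpM2l// addr_ge0// divr_ge0 ?(ltW beta2)// addr_ge0// mulr_ge0.
rewrite -sqrtrM ?(ltW P_gt0)// ler_wsqrtr//.
have rrM : rr + qq <= M0 * ZZ.
  have a0V : 0 < a0^-1 by rewrite invr_gt0.
  have rz' : rr <= a0^-1 * zz by rewrite ler_pdivlMl.
  have := mulr_ge0 (ltW a0V) qq0; rewrite /M0 ZZE; lra.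
apply: (le_trans rrM); rewrite -mulrA ler_wpM2l// ?(ltW M0_gt0)//.
have := mulr_ge0 K0 EE0; lra.
Qed.
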